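(* Let $X$ be a Tychonoff space which contains an infinite compact subset. Let $E$ be a locally convex space which contains an isomorphic copy of the Banach space $\ell_1$. Then $C_p(X,E_w)$ contains a complemented copy of $(c_0)_p$.
   Context: Locally convex spaces are real and Hausdorff. $E_w$ denotes $E$ endowed with its weak topology $\sigma(E,E')$. $\ell_1$ is the Banach space of absolutely summable real sequences; ''$E$ contains an isomorphic copy of $\ell_1$'' means some linear subspace of $E$ (with the topology inherited from $E$) is linearly homeomorphic to $\ell_1$. For a locally convex space $F$, $C_p(X,F)$ is the space of all continuous functions $X\to F$ with the pointwise topology (inherited from the product $F^X$). Tychonoff means completely regular and Hausdorff. $(c_0)_p=\{x\in\mathbb{R}^\omega: x(n)\to 0\}$ with the topology inherited from the product $\mathbb{R}^\omega$. A locally convex space $G$ contains a complemented copy of $F$ if there are closed linear subspaces $G_1,G_2$ of $G$ with $G=G_1\oplus G_2$ algebraically, $G_1$ linearly homeomorphic to $F$, and the natural projection of $G$ onto $G_1$ continuous. *)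

(* Defs.v *)
From HB Require Import structures.
From mathcomp Require Import all_boot all_order all_algebra.
From mathcomp Require Import all_classical all_reals all_analysis.

Set Implicit Arguments.
Unset Strict Implicit.
Unset Printing Implicit Defensive.

Import Order.TTheory GRing.Theory Num.Theory.
Import numFieldNormedType.Exports.

Local Open Scope classical_set_scope.
Local Open Scope ring_scope.

(** Locally convex spaces are [tvsType R] ([R : realType]); the Hausdorff
    property is not part of [tvsType] and is stated separately. *)

Lemma cvg_initialP (S : choiceType) (T : topologicalType) (f : S -> T)
    (F : set_system S) (x : S) : Filter F ->
  F --> (x : initial_topology f) <-> f @ F --> f x.
Proof.
move=> FF; split=> [Fx|Ffx].
  by move=> B nB; apply: Fx; exact: (@initial_continuous S T f x B nB).
move=> A [_ [[B Bop <-] Bfx BA]].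
have FB : F (f @^-1` B) by exact: (Ffx B (open_nbhs_nbhs (conj Bop Bfx))).
exact: (filterS BA FB).
Qed.

(** The topology of [V] is initial for a family of linear maps into locally
    convex spaces: then [V] is itself locally convex. *)
Section initial_tvs.
Context (R : realType) (V : preTopologicalLmodType R) (I : Type).
Context (W : I -> tvsType R) (f : forall i, {linear V -> W i}).
Hypothesis cvgV : forall (F : set_system V) (x : V), Filter F ->
  F --> x <-> forall i, f i @ F --> f i x.

Let f_cts i : continuous (f i).
Proof. by move=> x; have [+ _] := cvgV x (nbhs_filter x); apply. Qed.

Let cvgW (F : set_system V) (x : V) : Filter F ->
  (forall i, f i @ F --> f i x) -> F --> x.
Proof. by move=> FF; exact: (cvgV x FF).2. Qed.

Lemma initial_add_continuous : continuous (fun x : V * V => x.1 + x.2).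
Proof.
move=> [x y]; refine (@cvgW _ _ _ _) => i /=.
rewrite linearD -fmap_comp.
have -> : f i \o (fun z : V * V => z.1 + z.2) = fun z => f i z.1 + f i z.2.
  by apply/funext => z /=; rewrite linearD.
have fxy : (fun z : V * V => (f i z.1, f i z.2)) @ (x, y) --> (f i x, f i y).
  apply: cvg_pair => /=.
    exact: (cvg_comp _ _ (@cvg_fst V V _ _ _) (f_cts (x := x))).
  exact: (cvg_comp _ _ (@cvg_snd _ V _ _ _) (f_cts (x := y))).
exact: (cvg_comp _ _ fxy (@add_continuous (W i) (f i x, f i y))).
Qed.

Lemma initial_scale_continuous : continuous (fun z : R^o * V => z.1 *: z.2).
Proof.
move=> [k y]; refine (@cvgW _ _ _ _) => i /=.
rewrite linearZ -fmap_comp.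
have -> : f i \o (fun z : R^o * V => z.1 *: z.2) = fun z => z.1 *: f i z.2.
  by apply/funext => z /=; rewrite linearZ.
have fky : (fun z : R^o * V => (z.1, f i z.2)) @ (k, y) --> (k, f i y).
  apply: (@cvg_pair _ _ _ _ (nbhs (k : R^o))); first exact: cvg_fst.
  exact: (cvg_comp _ _ (@cvg_snd _ V _ _ _) (f_cts (x := y))).
exact: (cvg_comp _ _ fky (@scale_continuous R (W i) (k, f i y))).
Qed.

Lemma initial_locally_convex : exists2 B : set_system V,
  (forall b, b \in B -> convex_set b) & basis B.
Proof.
exists [set b : set V | open b /\ convex_set b].
  by move=> b; rewrite inE => -[].
split=> [b []//|x].
apply: cvgW.
  apply: filter_from_filter.
    exists setT; split=> //; split; first exact: openT.
    by move=> *; rewrite inE.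
  move=> b c [[ob cb] bx] [[oc cc] cx]; exists (b `&` c) => //.
  split=> //; split; first exact: openI.
  move=> u v l; rewrite !in_setI => /andP[ub uc] /andP[vb vc].
  by rewrite cb// cc.
move=> i U; have [B cB [oB /(_ (f i x) U)]] := @locally_convex R (W i).
move=> /[apply] -[b [Bb bx] bU].
exists (f i @^-1` b); last by move=> v /bU.
split=> //; split.
  by apply: open_comp; [move=> ? _; exact: f_cts|exact: oB].
move=> u v l; rewrite !inE /= => bu bv.
have := cB b (mem_set Bb) (f i u) (f i v) l (mem_set bu) (mem_set bv).
by rewrite inE; congr (b _); rewrite /conv/= linearD !linearZ.
Qed.

End initial_tvs.

HB.instance Definition _ (R : realType) (X : Type) (F : tvsType R) :=
  GRing.Lmodule.copy {ptws X -> F} (X -> F).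

Section ptws_tvs.
Context (R : realType) (X : Type) (F : tvsType R).
Local Notation P := {ptws X -> F}.

Definition ptws_eval (x : X) (g : P) : F := g x.

Let ptws_eval_linear x : linear (ptws_eval x). Proof. by []. Qed.
HB.instance Definition _ x :=
  GRing.isLinear.Build R P F *:%R (ptws_eval x) (@ptws_eval_linear x).

Lemma cvg_ptwsP (G : set_system P) (g : P) : Filter G ->
  G --> g <-> forall x, ptws_eval x @ G --> ptws_eval x g.
Proof.
move=> FG; split=> [/cvg_sup Gg x|Gg]; last apply/cvg_sup => x.
  exact: (@cvg_initialP P F (ptws_eval x) G g FG).1 (Gg x).
exact: (@cvg_initialP P F (ptws_eval x) G g FG).2 (Gg x).
Qed.

HB.instance Definition _ := PreTopologicalNmodule_isTopologicalNmodule.Build P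
  (initial_add_continuous cvg_ptwsP).
HB.instance Definition _ := TopologicalNmodule_isTopologicalLmodule.Build R P
  (initial_scale_continuous cvg_ptwsP).
HB.instance Definition _ := Uniform_isTvs.Build R P
  (initial_locally_convex cvg_ptwsP).

End ptws_tvs.

(** The linear subspace [A] of [V], as a locally convex space *)
Definition sub_tvs (R : realType) (V : tvsType R) (A : set V)
  (A_submod : submod_closed [in A]) : Type := set_type A.

Section sub_tvs.
Context (R : realType) (V : tvsType R) (A : set V).
Context (A_submod : submod_closed [in A]).
Local Notation S := (sub_tvs A_submod).

HB.instance Definition _ := Uniform.on S.
HB.instance Definition _ := SubChoice.on S.
HB.instance Definition _ :=
  GRing.SubChoice_isSubLmodule.Build R V [in A] S A_submod.

Lemma cvg_sub_tvsP (G : set_system S) (x : S) : Filter G ->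
  G --> x <-> forall _ : unit, (\val : S -> V) @ G --> \val x.
Proof.
move=> FG; have cvgP := @cvg_initialP (set_type A) V set_val G x FG.
by split=> [/cvgP Gx _|/(_ tt) /cvgP].
Qed.

HB.instance Definition _ := PreTopologicalNmodule_isTopologicalNmodule.Build S
  (initial_add_continuous cvg_sub_tvsP).
HB.instance Definition _ := TopologicalNmodule_isTopologicalLmodule.Build R S
  (initial_scale_continuous cvg_sub_tvsP).
HB.instance Definition _ := Uniform_isTvs.Build R S
  (initial_locally_convex cvg_sub_tvsP).

End sub_tvs.

(** [E] with its weak topology [sigma(E, E')] *)
Section weak.
Context (R : realType) (E : tvsType R).

Definition dual : Type := {f : {linear E -> R^o} | continuous f}.

Definition weak : Type :=
  sup_topology (fun f : dual => Uniform.class (initial_topology (sval f))).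

HB.instance Definition _ := Uniform.on weak.
HB.instance Definition _ := GRing.Lmodule.copy weak E.

Definition weak_eval (f : dual) (x : weak) : R^o := sval f x.

Let weak_eval_linear f : linear (weak_eval f).
Proof. by move=> a x y; rewrite /weak_eval linearP. Qed.
HB.instance Definition _ f :=
  GRing.isLinear.Build R weak R^o *:%R (weak_eval f) (@weak_eval_linear f).

Lemma cvg_weakP (G : set_system weak) (x : weak) : Filter G ->
  G --> x <-> forall f, weak_eval f @ G --> weak_eval f x.
Proof.
move=> FG; split=> [/cvg_sup Gx f|Gx]; last apply/cvg_sup => f.
  exact: (@cvg_initialP E R^o (sval f) G x FG).1 (Gx f).
exact: (@cvg_initialP E R^o (sval f) G x FG).2 (Gx f).
Qed.

HB.instance Definition _ := PreTopologicalNmodule_isTopologicalNmodule.Build weak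
  (initial_add_continuous cvg_weakP).
HB.instance Definition _ := TopologicalNmodule_isTopologicalLmodule.Build R weak
  (initial_scale_continuous cvg_weakP).
HB.instance Definition _ := Uniform_isTvs.Build R weak
  (initial_locally_convex cvg_weakP).

End weak.

Lemma continuous_submod (R : realType) (X : topologicalType) (F : tvsType R) :
  submod_closed [in [set g : {ptws X -> F} | continuous (g : X -> F)]].
Proof.
split=> [|a g h]; rewrite !inE /=.
  by move=> x; exact: cvg_cst.
move=> cg ch x.
have agx : (fun y => (a, g y)) @ x --> (a : R^o, g x).
  by apply: (@cvg_pair _ _ _ _ (nbhs (a : R^o))); [exact: cvg_cst|exact: cg].
have {}agx := cvg_comp _ _ agx (@scale_continuous R F (a, g x)).
exact: (cvg_comp _ _ (cvg_pair agx (ch x))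
  (@add_continuous F (a *: g x, h x))).
Qed.

(** Continuous functions with the pointwise topology, inherited from [F^X] *)
Definition Cp (R : realType) (X : topologicalType) (F : tvsType R) : tvsType R :=
  sub_tvs (@continuous_submod R X F).

Lemma c0_submod (R : realType) :
  submod_closed [in [set x : {ptws nat -> R^o} | x n @[n --> \oo] --> (0 : R^o)]].
Proof.
split=> [|a x y]; rewrite !inE /=; first exact: cvg_cst.
move=> x0 y0; have ax0 : a *: x n @[n --> \oo] --> (a *: 0 : R^o).
  exact: (@cvgZl_tmp R R^o).
have := cvgD ax0 y0; rewrite scaler0 addr0; apply.
Qed.

(** Null sequences with the topology inherited from the product [R^nat] *)
Definition c0p (R : realType) : tvsType R := sub_tvs (@c0_submod R).

Section l1.
Context (R : realType).

Definition absolutely_summable : set (nat -> R^o) :=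
  [set x | cvgn (series (fun n => `|x n| : R))].

Lemma absolutely_summable_submod : submod_closed [in absolutely_summable].
Proof.
split=> [|a x y]; rewrite !inE /absolutely_summable /=.
  rewrite (_ : series _ = cst 0); first exact: is_cvg_cst.
  by apply/funext => n; rewrite /series/= big1// => i _; rewrite normr0.
move=> sx sy.
apply: (@series_le_cvg R _ (`|a| *: (fun n => `|x n|) + (fun n => `|y n|))).
- by move=> n.
- by move=> n; rewrite addr_ge0// mulr_ge0.
- by move=> n; rewrite (le_trans (ler_normD _ _))// lerD2r normrZ.
- by apply: is_cvg_seriesD => //; exact: is_cvg_seriesZ.
Qed.

(** The Banach space of absolutely summable real sequences *)
Definition l1 : Type := {x : nat -> R^o | x \in absolutely_summable}.

HB.instance Definition _ := SubChoice.on l1.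
HB.instance Definition _ := GRing.SubChoice_isSubLmodule.Build R (nat -> R^o)
  [in absolutely_summable] l1 absolutely_summable_submod.

Definition l1_norm (x : l1) : R := limn (series (fun n => `|(\val x : nat -> R^o) n| : R)).

Let l1_summable (x : l1) : cvgn (series (fun n => `|(\val x : nat -> R^o) n| : R)).
Proof. exact: set_mem (valP x). Qed.

Let l1_normD x y : l1_norm (x + y) <= l1_norm x + l1_norm y.
Proof.
rewrite /l1_norm -lim_seriesD//; apply: lim_series_le => //.
  exact: is_cvg_seriesD.
by move=> n; rewrite linearD; exact: ler_normD.
Qed.

Let l1_normZ a x : l1_norm (a *: x) = `|a| * l1_norm x.
Proof.
rewrite /l1_norm -[RHS]lim_seriesZ//; congr (limn (series _)).
by apply/funext => n; rewrite linearZ /= normrZ.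
Qed.

Let l1_norm0_eq0 x : l1_norm x = 0 -> x = 0.
Proof.
move=> x0; apply/val_inj/funext => n /=.
have ndx : nondecreasing_seq (series (fun n => `|(\val x : nat -> R^o) n| : R)).
  by apply: nondecreasing_series => i _ _.
have := nondecreasing_cvgn_le ndx (@l1_summable x) n.+1.
rewrite -/(l1_norm x) x0 /series/= big_nat_recr//= => xn.
apply/normr0_eq0/eqP; rewrite eq_le normr_ge0 andbT.
by apply: le_trans xn; rewrite lerDr sumr_ge0.
Qed.

HB.instance Definition _ :=
  Lmodule_isNormed.Build R l1 l1_normD l1_normZ l1_norm0_eq0.

End l1.

Definition tychonoff_space (X : topologicalType) : Prop :=
  completely_regular_space X /\ hausdorff_space X.

(** The subset [A] of [G], with the topology inherited from [G], is linearly
    homeomorphic to [F]; [S] matters only on [A]. *)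
Definition linearly_homeomorphic_to (R : realType) (G : tvsType R) (A : set G)
    (F : tvsType R) : Prop :=
  exists (T : {linear F -> G}) (S : G -> F),
    [/\ forall x, A (T x), cancel T S, {in A, cancel S T},
        continuous T & {within A, continuous S}].

Definition contains_copy (R : realType) (G F : tvsType R) : Prop :=
  exists A : set G, submod_closed [in A] /\ linearly_homeomorphic_to A F.

Definition direct_sum (R : realType) (G : lmodType R) (A B : set G) : Prop :=
  [set x + y | x in A & y in B] = [set: G] /\ A `&` B = [set 0].

(** [p] is the projection onto [G1] along [G2], unique since the sum is
    direct. *)
Definition contains_complemented_copy (R : realType) (G F : tvsType R) : Prop :=
  exists G1 G2 : set G,
    [/\ submod_closed [in G1] /\ closed G1,
        submod_closed [in G2] /\ closed G2,
        direct_sum G1 G2,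
        linearly_homeomorphic_to G1 F &
        exists2 p : G -> G, forall x, G1 (p x) /\ G2 (x - p x) & continuous p].

(* Main.v *)
From HB Require Import structures.
Require Import Defs.
From mathcomp Require Import all_boot all_order all_algebra.
From mathcomp Require Import all_classical all_reals all_analysis.
From mathcomp Require Import ring lra.

(** The copy of [c0p] consists of the functions [\sum_n a n *: (psi n * e n)],
    where the [psi n] are continuous bumps with disjoint supports, equal to [1]
    at points [t n] of the compact set, and the [e n] are the unit vectors of
    the copy of [l1]. Such a sum is continuous as [a] tends to [0] and [e] is
    bounded, and it depends continuously on [a] for the pointwise topologies
    because at each point of [X] only one term is nonzero. It remains to find
    a continuous left inverse, and [h |-> (f n (h (t n)))_n] is one as soon as
    the [f n] in the dual of [E] satisfy [f n (e n) = 1] and [f n (h (t n))]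
    tends to [0] for every weakly continuous [h]. Everything lies in the choice
    of [f]: extensions by Hahn-Banach of the coordinates of [l1] need not do,
    since nothing but the weak compactness of the image of [h] is available.

    The classical remedy is that the map from [l1] to [l2] that sends unit
    vectors to unit vectors is 2-summing, so that it extends to [E], and that
    2-summing maps turn weakly compact sets into norm compact sets, on which
    the coordinates of [l2] tend to [0] uniformly. The following is a direct
    version of this. For every finite sequence of signs [s] the functional
    [x |-> \sum_n r n s * x n] on [l1], where [r n s] is the sign of index
    [n], extends to a functional [F s] on [E] dominated by a continuous
    seminorm independent of [s] ([l1_copy_functionals]). Let [M] be an
    ultrafilter limit of the averages over the sign sequences of length [N];
    it is a finitely additive mean for which the [r n] are orthonormal. Then
    [f n v = M (s |-> r n s * F s v)] satisfies [f n (e n) = M (r n ^+ 2) = 1].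

    Put [H n s = F s (h (t n))]. This is a bounded function, by the principle
    of uniform boundedness ([equicontinuous_uniform_bound]), and its iterated
    limits in [n] and [s] commute: the points [t n] have a limit [x] in the
    compact set, the functionals [F s] have a pointwise limit [G] in the dual
    of [E], and both iterated limits are [G (h x)] ([coefficient_cvg0]).

    These two properties entail that [M (r n * H n)] tends to [0]
    ([orthonormal_iterated_limits_cvg0]). By Bessel's inequality this is so
    when [H n] does not depend on [n]; hence, if it fails, after subtraction
    of a pointwise limit and passage to a subsequence one gets functions [Z k]
    that tend to [0] pointwise along an ultrafilter while the means of the sets
    [`|Z k| >= c] are bounded below. As [M] is not countably additive, there
    is no dominated convergence theorem to exclude this. But such sets are
    correlated enough ([mean_correlated]) to choose successively [n j] and
    [s j] such that [`|Z (n i) (s j)|] is at least [c] for [i <= j] and at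
    most [c / 2] for [i > j] ([mean_chain]), whose iterated limits do not
    commute. *)
Set Implicit Arguments.
Unset Strict Implicit.
Unset Printing Implicit Defensive.

Import Order.TTheory GRing.Theory Num.Theory.
Import numFieldNormedType.Exports.

Local Open Scope classical_set_scope.
Local Open Scope ring_scope.

(** * The Hahn-Banach theorem *)

Section hahn_banach.
Context (R : realType) (V : lmodType R).
Implicit Types (p q : V -> R) (v w : V).

(** With an inequality for [a > 0] only, so that infima of families are easily
    seen to be sublinear; equality for [a >= 0] is [sublinearZ]. *)
Definition sublinear p :=
  (forall v w, p (v + w) <= p v + p w) /\
  (forall a v, 0 < a -> p (a *: v) <= a * p v).

Lemma sublinear0 p : sublinear p -> p 0 = 0.
Proof.
move=> [_ pZ]; have := pZ 2 0 ltac:(by []); rewrite scaler0 => p0.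
have := pZ 2^-1 0 ltac:(by rewrite invr_gt0); rewrite scaler0 => p1.
lra.
Qed.

Lemma sublinearZ p a v : sublinear p -> 0 <= a -> p (a *: v) = a * p v.
Proof.
move=> sp; rewrite le_eqVlt => /predU1P[<-|a0].
  by rewrite scale0r mul0r sublinear0.
have [_ pZ] := sp; apply/eqP; rewrite eq_le pZ//=.
have := pZ a^-1 (a *: v) ltac:(by rewrite invr_gt0).
by rewrite scalerA mulVf ?gt_eqF// scale1r mulrC ler_pdivlMr// mulrC.
Qed.

Lemma sublinear_geN p v : sublinear p -> - p (- v) <= p v.
Proof.
by move=> sp; have := sp.1 v (- v); rewrite subrr sublinear0//; lra.
Qed.

Lemma inf_sublinear (I : V -> set R) :
  (forall v, I v !=set0) -> (forall v, has_lbound (I v)) ->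
  (forall v w x y, I v x -> I w y -> exists2 z, I (v + w) z & z <= x + y) ->
  (forall a v x, 0 < a -> I v x -> I (a *: v) (a * x)) ->
  sublinear (fun v => inf (I v)).
Proof.
move=> I0 lI ID IZ; split=> [v w|a v a0].
  rewrite -lerBlDr; apply: lb_le_inf => // x Ivx.
  rewrite lerBlDl -lerBlDr; apply: lb_le_inf => // y Iwy.
  have [z Iz zxy] := ID _ _ _ _ Ivx Iwy.
  by rewrite lerBlDr (addrC y) (le_trans _ zxy)// ge_inf.
rewrite mulrC -ler_pdivrMr//; apply: lb_le_inf => // x Ix.
by rewrite ler_pdivrMr// mulrC ge_inf//; exact: IZ.
Qed.

(** The functional is [v |-> inf_(c in C) p (v + c.1) + c.2], the largest one
    below [p] that meets all the constraints in the convex cone [C]. It serves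
    twice: to pass below a functional given on a subspace, and to show that
    minimal functionals are additive. *)
Lemma sublinear_below p (C : set (V * R)) :
  sublinear p -> C (0, 0) ->
  (forall c d, C c -> C d -> C (c.1 + d.1, c.2 + d.2)) ->
  (forall a c, 0 < a -> C c -> C (a *: c.1, a * c.2)) ->
  (forall c, C c -> 0 <= p c.1 + c.2) ->
  exists q, [/\ sublinear q, forall v, q v <= p v &
                forall c, C c -> q (- c.1) <= c.2].
Proof.
move=> sp C0 CD CZ pC.
pose I v := [set p (v + c.1) + c.2 | c in C].
have I0 v : I v !=set0 by exists (p (v + 0) + 0), (0, 0).
have lI v : has_lbound (I v).
  exists (- p (- v)) => _ [c Cc <-]; have := pC _ Cc.
  by have := sp.1 (- v) (v + c.1); rewrite addKr; lra.
exists (fun v => inf (I v)); split=> [|v|c Cc].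
- apply: inf_sublinear => //.
    move=> v w _ _ [c Cc <-] [d Cd <-].
    exists (p (v + w + (c.1 + d.1)) + (c.2 + d.2)).
      by exists (c.1 + d.1, c.2 + d.2) => //; exact: CD.
    by rewrite addrACA; have := sp.1 (v + c.1) (w + d.1); lra.
  move=> a v _ a0 [c Cc <-]; exists (a *: c.1, a * c.2); first exact: CZ.
  by rewrite /= -scalerDr sublinearZ ?ltW// mulrDr.
- by apply: ge_inf => //; exists (0, 0) => //=; rewrite !addr0.
- by apply: ge_inf => //; exists c => //; rewrite addNr sublinear0// add0r.
Qed.

(** Zorn's lemma: along a chain the pointwise infimum is sublinear, and finite
    because [q v >= - q (- v) >= - p (- v)] for a sublinear [q] below [p]. *)
Lemma minimal_sublinear p : sublinear p ->
  exists q, [/\ sublinear q, forall v, q v <= p v &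
    forall q', sublinear q' -> (forall v, q' v <= q v) -> q' = q].
Proof.
move=> sp; pose S := {q : V -> R | sublinear q /\ forall v, q v <= p v}.
pose rel (s t : S) := `[< forall v, sval t v <= sval s v >].
have [|||A totA|[q [sq qp]] qmin] := @Zorn S rel.
- by move=> s; apply/asboolP.
- move=> r s t /asboolP rs /asboolP st; apply/asboolP => v.
  exact: le_trans (st v) (rs v).
- move=> [s sP] [t tP] /asboolP/= st /asboolP/= ts; apply: eq_exist.
  by apply/funext => v; apply/eqP; rewrite eq_le ts st.
- have [[s0 As0]|A0] := pselect (A !=set0); last first.
    exists (exist _ p (conj sp (fun=> lexx _))) => s As.
    by exfalso; apply: A0; exists s.
  pose I v := [set sval s v | s in A].
  have lI v : has_lbound (I v).
    exists (- p (- v)) => _ [[s [ss sp']] As <-] /=.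
    by rewrite (le_trans _ (sublinear_geN v ss))// lerN2.
  have I0 v : I v !=set0 by exists (sval s0 v), s0.
  have sq : sublinear (fun v => inf (I v)).
    apply: inf_sublinear => //.
      move=> v w _ _ [s As <-] [t At <-].
      have [/asboolP st|/asboolP ts] := totA s t As At.
        exists (sval t (v + w)); first by exists t.
        rewrite (le_trans ((svalP t).1.1 v w))// lerD2r; exact: st.
      exists (sval s (v + w)); first by exists s.
      rewrite (le_trans ((svalP s).1.1 v w))// lerD2l; exact: ts.
    move=> a v _ a0 [s As <-]; exists s => //.
    by rewrite sublinearZ ?ltW//; exact: (svalP s).1.
  have qp v : inf (I v) <= p v.
    by apply: le_trans ((svalP s0).2 v); apply: ge_inf => //; exists s0.
  exists ((exist _ (fun v => inf (I v)) (conj sq qp)) : S) => s As.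
  apply/asboolP => v /=.
  by apply: ge_inf => //; exists s.
- exists q; split=> // q' sq' q'q.
  have q'p v : q' v <= p v by exact: le_trans (q'q v) (qp v).
  have := qmin ((exist _ q' (conj sq' q'p)) : S).
  by move=> /(_ ltac:(by apply/asboolP))/(congr1 sval).
Qed.

(** By minimality [q] coincides with [v |-> inf_(t >= 0) q (v + t w) - t q w],
    so that [q (- w) <= - q w], whence [q v + q w <= q (v + w)]. *)
Lemma minimal_sublinear_additive q : sublinear q ->
  (forall q', sublinear q' -> (forall v, q' v <= q v) -> q' = q) ->
  {morph q : v w / v + w}.
Proof.
move=> sq qmin v w; apply/eqP; rewrite eq_le sq.1 /=.
pose C := [set (t *: w, - (t * q w)) | t in [set t | 0 <= t]].
have [|||c|q' [sq' q'q q'C]] := sublinear_below sq (C := C) _ _ _ _.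
- by exists 0 => //=; rewrite scale0r mul0r oppr0.
- move=> _ _ [s s0 <-] [t t0 <-]; exists (s + t); first exact: addr_ge0.
  by rewrite /= scalerDl mulrDl opprD.
- move=> a _ a0 [t t0 <-]; exists (a * t); first by rewrite /= mulr_ge0// ltW.
  by rewrite /= scalerA mulrN mulrA.
- by move=> [t t0 <-] /=; rewrite sublinearZ// subrr.
have := q'C (w, - q w); rewrite (qmin q' sq' q'q) /= => qNw.
have {}qNw : q (- w) <= - q w.
  by apply: qNw; exists 1 => //=; rewrite scale1r mul1r.
by have := sq.1 (v + w) (- w); rewrite addrK; lra.
Qed.

(** The functional to extend lives on a space [L] mapped into [V] rather than on
    a subspace; domination forces it to vanish on the kernel of [T]. *)
Theorem hahn_banach (L : lmodType R) (T : {linear L -> V})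
    (g : {linear L -> R^o}) p : sublinear p -> (forall x, g x <= p (T x)) ->
  exists F : {linear V -> R^o}, (forall x, F (T x) = g x) /\
    (forall v, F v <= p v).
Proof.
move=> sp gp; pose C := [set (- T x, g x : R) | x in [set: L]].
have [|||c|p' [sp' p'p p'C]] := sublinear_below sp (C := C) _ _ _ _.
- by exists 0 => //; rewrite !linear0.
- move=> _ _ [x _ <-] [y _ <-]; exists (x + y) => //=.
  by rewrite !linearD.
- move=> a _ a0 [x _ <-]; exists (a *: x) => //=.
  by rewrite !linearZ.
- move=> [x _ <-] /=; have := gp (- x); rewrite !linearN /=; lra.
(* A minimal [q] is linear; [q (T x) <= g x] for all [x] then gives equality. *)
have [q [sq qp' qmin]] := minimal_sublinear sp'.
have qD := minimal_sublinear_additive sq qmin.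
have qN v : q (- v) = - q v.
  by have := qD v (- v); rewrite subrr sublinear0//; lra.
have qlin : linear (q : V -> R^o).
  move=> a v w; rewrite qD; congr (_ + _).
  have [a0|a0] := leP 0 a; first exact: sublinearZ.
  by rewrite -[a]opprK scaleNr qN sublinearZ ?oppr_ge0 ?ltW// -mulNr.
pose qm := GRing.isLinear.Build R V R^o *:%R q qlin.
pose F : {linear V -> R^o} := HB.pack (q : V -> R^o) qm.
exists F; split=> [x|v]; last by rewrite (le_trans (qp' v)).
have qT y : q (T y) <= g y.
  have := p'C (- T y, g y) (ex_intro2 _ _ y I erefl); rewrite /= opprK.
  exact: le_trans.
apply/eqP; rewrite eq_le /= qT /=.
by have := qT (- x); rewrite !linearN qN lerN2.
Qed.

End hahn_banach.

(** * Continuous seminorms on a locally convex space *)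

Section seminorms.
Context (R : realType) (E : tvsType R).
Implicit Types (p : E -> R) (U : set E).

Definition seminorm p := (forall v w, p (v + w) <= p v + p w) /\
  (forall a v, p (a *: v) = `|a| * p v).

Lemma seminorm_sublinear p : seminorm p -> sublinear p.
Proof. by move=> [pD pZ]; split=> // a v a0; rewrite pZ gtr0_norm. Qed.

Lemma seminormN p v : seminorm p -> p (- v) = p v.
Proof. by move=> sp; rewrite -scaleN1r sp.2 normrN1 mul1r. Qed.

Lemma seminorm_ge0 p v : seminorm p -> 0 <= p v.
Proof.
move=> sp; have := sp.1 v (- v).
by rewrite subrr (sublinear0 (seminorm_sublinear sp)) seminormN//; lra.
Qed.

Lemma le_seminorm_norm p (F : {linear E -> R^o}) : seminorm p ->
  (forall v, F v <= p v) -> forall v, `|F v| <= p v.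
Proof.
move=> sp Fp v; rewrite ler_norml Fp andbT lerNl -linearN.
by rewrite (le_trans (Fp _))// seminormN.
Qed.

Definition continuous_seminorm p := seminorm p /\ nbhs 0 [set v | p v <= 1].

Lemma nbhs0_scale U a : nbhs (0 : E) U -> nbhs (0 : E) [set v | U (a *: v)].
Proof.
move=> U0; have := @scale_continuous R E (a, 0); rewrite /= => /(_ U).
rewrite /= scaler0 => /(_ U0)[[A B] /= [Aa B0] ABU].
apply: filterS B0 => v Bv; apply: (ABU (a, v)); split=> //.
exact: nbhs_singleton.
Qed.

Lemma nbhs_translate U x : nbhs (0 : E) U -> nbhs x [set v | U (v - x)].
Proof.
move=> U0; have := @sub_continuous E (x, x); rewrite /= => /(_ U).
rewrite /= subrr => /(_ U0)[[A B] /= [Ax Bx] ABU].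
apply: filterS Ax => v Av; apply: (ABU (v, x)); split=> //.
exact: nbhs_singleton.
Qed.

Lemma dominated_continuous p (F : {linear E -> R^o}) c :
  continuous_seminorm p -> (forall v, `|F v| <= c * p v) ->
  continuous (F : E -> R^o).
Proof.
move=> [sp p1] Fp x; apply/cvgrPdist_le => e e0.
pose k := `|c| + 1; have k0 : 0 < k by rewrite ltr_wpDl.
have := nbhs_translate x (nbhs0_scale (k / e) p1).
apply: filterS => v /=.
rewrite sp.2 ger0_norm; last by rewrite divr_ge0 ?ltW.
rewrite -normrN opprB -linearB mulrAC ler_pdivrMr// mul1r.
apply: le_trans; rewrite (le_trans (Fp _))// ler_wpM2r ?seminorm_ge0//.
by rewrite (le_trans (ler_norm _))// lerDl.
Qed.

(** The seminorm is the gauge of [b `&` - b] for a convex neighbourhood [b] of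
    [0] inside [U]. *)
Lemma exists_continuous_seminorm U : nbhs (0 : E) U ->
  exists2 p, continuous_seminorm p & forall v, p v < 1 -> U v.
Proof.
have [B cB [oB bB]] := @locally_convex R E.
move=> /(bB 0 U)[b [Bb b0] bU].
have nb : nbhs 0 b by apply: open_nbhs_nbhs; split=> //; exact: oB.
have cb v w (l : R) : 0 <= l -> l <= 1 -> b v -> b w ->
    b (l *: v + (1 - l) *: w).
  move=> l0 l1 bv bw.
  have := cB b (mem_set Bb) v w (Itv01 l0 l1) (mem_set bv) (mem_set bw).
  by move=> /set_mem.
pose I v := [set l : R | [/\ 0 < l, b (l^-1 *: v) & b (- (l^-1 *: v))]].
have I0 v : I v !=set0.
  have := @scale_continuous R E (0, v).
  rewrite /= => /(_ (b `&` [set w | b (- w)])).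
  rewrite /= scale0r => /(_ _)[|[A V] /= [A0 Vv] AV].
    apply: filterI => //; apply: filterS (nbhs0_scale (-1) nb) => w /=.
    by rewrite scaleN1r.
  have [e /= e0 eA] := A0.
  have {}AV a : `|a| < e -> b (a *: v) /\ b (- (a *: v)).
    move=> ae; apply: (AV (a, v)); split=> /=; last exact: nbhs_singleton.
    by apply: eA; rewrite /= sub0r normrN.
  have [|b1 b2] := AV (e / 2).
    by rewrite ger0_norm ?divr_ge0 ?(ltW e0)// ltr_pdivrMr// ltr_pMr// ltr1n.
  by exists (e / 2)^-1; split; rewrite ?invr_gt0 ?divr_gt0 ?invrK.
have lI v : has_lbound (I v) by exists 0 => l [/ltW].
have IN v : I (- v) = I v.
  rewrite /I; under eq_set do rewrite scalerN opprK.
  by apply/seteqP; split=> l [].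
have sp : sublinear (fun v => inf (I v)).
  apply: inf_sublinear => //
    [v w l m [l0 l1 l2] [m0 m1 m2]|a v l a0 [l0 l1 l2]].
    have lm0 : 0 < l + m by rewrite addr_gt0.
    exists (l + m) => //; pose t := l / (l + m).
    have t0 : 0 <= t by rewrite divr_ge0// ltW.
    have t1 : t <= 1 by rewrite ler_pdivrMr// mul1r lerDl ltW.
    have tl : t * l^-1 = (l + m)^-1.
      by rewrite /t mulrAC mulfV ?gt_eqF// mul1r.
    have tm : (1 - t) * m^-1 = (l + m)^-1.
      by rewrite /t; field; rewrite !gt_eqF.
    split=> //.
      have := cb _ _ t t0 t1 l1 m1.
      by rewrite !scalerA tl tm -scalerDr.
    have := cb _ _ t t0 t1 l2 m2.
    by rewrite !scalerN !scalerA tl tm -opprD -scalerDr.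
  by split; rewrite ?mulr_gt0// invfM scalerA mulrAC mulVf ?gt_eqF// mul1r.
exists (fun v => inf (I v)); last first.
  move=> v /(inf_lt (I0 v))[l [l0 bl _] l1]; apply: bU.
  have := cb _ _ l (ltW l0) (ltW l1) bl b0.
  by rewrite scaler0 addr0 scalerA mulfV ?gt_eqF// scale1r.
split; first split; first exact: sp.1.
  move=> a v; have [a0|a0] := ger0P a.
    exact: (@sublinearZ R E _ a v sp a0).
  rewrite -IN -scaleNr; apply: (@sublinearZ R E _ (- a) v sp).
  by rewrite oppr_ge0 ltW.
apply: filterS (filterI nb (nbhs0_scale (-1) nb)) => v [bv bNv] /=.
by apply: ge_inf => //; split; rewrite ?invr1 ?scale1r// -scaleN1r.
Qed.

(** A continuous seminorm [p] with [p v > 0] dominates the functional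
    [a *: v |-> a * p v] on the line of [v]. *)
Lemma separating_functional : hausdorff_space E -> forall v, v != 0 ->
  exists2 F : {linear E -> R^o}, continuous (F : E -> R^o) & F v != 0.
Proof.
move=> hE v v0.
have [U U0 Uv] : exists2 U, nbhs (0 : E) U & ~ U v.
  apply: contrapT => nU; move/eqP: v0; apply; apply: hE => A B Av B0.
  exists v; split; first exact: nbhs_singleton.
  by apply: contrapT => Bv; apply: nU; exists B.
have [p cp pU] := exists_continuous_seminorm U0.
have sp := cp.1.
have pv : 0 < p v.
  by rewrite (lt_le_trans ltr01)// leNgt; apply/negP => /pU.
pose T (a : R^o) : E := a *: v.
have lT : linear T by move=> a x y; rewrite /T scalerDl scalerA.
pose g (a : R^o) : R^o := a * p v.
have lg : linear g by move=> a x y; rewrite /g mulrDl -mulrA.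
pose T' : {linear R^o -> E} :=
  HB.pack T (GRing.isLinear.Build R R^o E *:%R T lT).
pose g' : {linear R^o -> R^o} :=
  HB.pack g (GRing.isLinear.Build R R^o R^o *:%R g lg).
have [|F [FT Fp]] := @hahn_banach R E R^o T' g' p (seminorm_sublinear sp).
  by move=> a /=; rewrite sp.2 ler_wpM2r ?ler_norm// ltW.
exists F.
  apply: (dominated_continuous (c := 1) cp) => w.
  by rewrite mul1r; exact: le_seminorm_norm.
by have := FT 1; rewrite /= /T /g scale1r mul1r => ->; rewrite gt_eqF.
Qed.

End seminorms.

(** * Limits along an ultrafilter of natural numbers *)

Section bounded_maps.
Context (R : realType) (Omega : Type).
Implicit Types (f g : Omega -> R).

Definition bounded_map f := exists C, forall s, `|f s| <= C.

Lemma bounded_mapP C f : (forall s, `|f s| <= C) -> bounded_map f.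
Proof. by exists C. Qed.

Lemma bounded_map_cst c : bounded_map (fun=> c).
Proof. by exists `|c|. Qed.

Lemma bounded_mapD f g : bounded_map f -> bounded_map g ->
  bounded_map (fun s => f s + g s).
Proof.
move=> [C fC] [D gD]; exists (C + D) => s.
by rewrite (le_trans (ler_normD _ _))// lerD.
Qed.

Lemma bounded_mapM f g : bounded_map f -> bounded_map g ->
  bounded_map (fun s => f s * g s).
Proof.
move=> [C fC] [D gD]; exists (C * D) => s.
by rewrite normrM ler_pM.
Qed.

Lemma bounded_mapN f : bounded_map f -> bounded_map (fun s => - f s).
Proof. by move=> [C fC]; exists C => s; rewrite normrN. Qed.

Lemma bounded_mapZ a f : bounded_map f -> bounded_map (fun s => a * f s).
Proof. by move=> ?; apply: bounded_mapM => //; exact: bounded_map_cst. Qed.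

Lemma bounded_mapB f g : bounded_map f -> bounded_map g ->
  bounded_map (fun s => f s - g s).
Proof. by move=> ? ?; apply: bounded_mapD => //; exact: bounded_mapN. Qed.

Lemma bounded_map_indic (A : set Omega) : bounded_map (\1_A).
Proof. by exists 1 => s; rewrite indicE ger0_norm// lern1 leq_b1. Qed.

Lemma bounded_map_norm f : bounded_map f -> bounded_map (fun s => `|f s|).
Proof. by move=> [C fC]; exists C => s; rewrite normr_id. Qed.

End bounded_maps.

Arguments bounded_map_cst {R Omega} c.

Section ultralimit.
Context (W : set_system nat) (WU : UltraFilter W).

(** Limits along a fixed ultrafilter replace the extraction of subsequences,
    which is impossible in a compact space that is not sequentially compact. *)
Lemma ultra_compact_cvg (T : topologicalType) (K : set T) (u : nat -> T) :
  compact K -> (forall n, K (u n)) -> exists2 l, K l & u @ W --> l.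
Proof.
move=> cK Ku; have [|l [Kl clu]] := cK (u @ W) _.
  by apply: (@filterS _ W) filterT => n _; exact: Ku.
exists l => // B Bl; have [//|WnB] := in_ultra_setVsetC (u @^-1` B) WU.
by have [t [tB /tB]] := clu (~` B) B WnB Bl.
Qed.

Context (R : realType).
Implicit Types u v : nat -> R.

Definition ulim u : R := lim (u @ W).

Lemma ulim_cvg u : bounded_map u -> u @ W --> ulim u.
Proof.
move=> [C uC]; have uI n : [set` `[(- C), C]] (u n).
  by rewrite /= in_itv /= -ler_norml.
have [l _ ul] := ultra_compact_cvg (@segment_compact _ _ _) uI.
by apply/cvg_ex; exists l.
Qed.

Lemma ulimE u l : u @ W --> l -> ulim u = l.
Proof. by move=> ul; rewrite /ulim (cvg_lim _ ul). Qed.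

Lemma normr_ulim_le u C : (forall n, `|u n| <= C) -> `|ulim u| <= C.
Proof.
move=> uC; apply: (cvgr_to_le (cvg_norm (ulim_cvg (bounded_mapP uC)))).
by apply: filterS filterT => n _; exact: uC.
Qed.

End ultralimit.

Section ultralimit_linear.
Context (R : realType) (W : set_system nat) (WU : UltraFilter W).
Local Notation ulim := (ulim W).

Lemma ulimP a (u v : nat -> R) : bounded_map u -> bounded_map v ->
  ulim (fun n => a * u n + v n) = a * ulim u + ulim v.
Proof.
move=> bu bv; apply: ulimE; apply: cvgD; last exact: ulim_cvg.
by apply: cvgMl_tmp; exact: ulim_cvg.
Qed.

Lemma ulim_linear (V : lmodType R) (G : nat -> V -> R^o) :
  (forall v, bounded_map (G^~ v)) -> (forall k, linear (G k)) ->
  linear ((fun v => ulim (G^~ v)) : V -> R^o).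
Proof.
move=> bG lG a v w; rewrite -[RHS]ulimP//.
by congr ulim; apply/funext => k; rewrite lG.
Qed.

End ultralimit_linear.

(** * Finitely additive means *)

Section means.
Context (R : realType) (Omega : Type).
Implicit Types (f g : Omega -> R).

(** The integral for a finitely additive probability. It takes all functions
    as arguments but is constrained on the bounded ones only. *)
Record mean (M : (Omega -> R) -> R) : Prop := Mean {
  meanP : forall a f g, bounded_map f -> bounded_map g ->
    M (fun s => a * f s + g s) = a * M f + M g ;
  mean_ge0 : forall f, bounded_map f -> (forall s, 0 <= f s) -> 0 <= M f ;
  mean1 : M (fun=> 1) = 1 }.

Section mean_theory.
Context (M : (Omega -> R) -> R) (mM : mean M).

Lemma mean_cst c : M (fun=> c) = c.
Proof.
have M0 : M (fun=> 0) = 0.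
  have := meanP mM 1 (bounded_map_cst 0) (bounded_map_cst 0).
  under eq_fun do rewrite mul1r addr0.
  by lra.
have := meanP mM c (bounded_map_cst 1) (bounded_map_cst 0).
by under eq_fun do rewrite mulr1 addr0; rewrite M0 mean1// mulr1 addr0.
Qed.

Lemma meanD f g : bounded_map f -> bounded_map g ->
  M (fun s => f s + g s) = M f + M g.
Proof.
move=> bf bg; have := meanP mM 1 bf bg; rewrite mul1r => <-.
by congr M; apply/funext => s; rewrite mul1r.
Qed.

Lemma meanZ a f : bounded_map f -> M (fun s => a * f s) = a * M f.
Proof.
move=> bf; have := meanP mM a bf (bounded_map_cst 0).
rewrite mean_cst addr0 => <-.
by congr M; apply/funext => s; rewrite addr0.
Qed.

Lemma meanN f : bounded_map f -> M (fun s => - f s) = - M f.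
Proof.
move=> bf; rewrite -[RHS]mulN1r -meanZ//.
by congr M; apply/funext => s; rewrite mulN1r.
Qed.

Lemma meanB f g : bounded_map f -> bounded_map g ->
  M (fun s => f s - g s) = M f - M g.
Proof. by move=> bf bg; rewrite meanD ?meanN//; exact: bounded_mapN. Qed.

Lemma le_mean f g : bounded_map f -> bounded_map g ->
  (forall s, f s <= g s) -> M f <= M g.
Proof.
move=> bf bg fg; rewrite -subr_ge0 -meanB//; apply: (mean_ge0 mM).
  exact: bounded_mapB.
by move=> s; rewrite subr_ge0.
Qed.

Lemma normr_mean f g : bounded_map f -> bounded_map g ->
  (forall s, `|f s| <= g s) -> `|M f| <= M g.
Proof.
move=> bf bg fg; rewrite ler_norml -meanN// !le_mean// => [s||s].
- by rewrite (le_trans (ler_norm _)).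
- exact: bounded_mapN.
- by rewrite lerNl (le_trans (ler_norm _))// normrN.
Qed.

Lemma normr_mean_le C f : (forall s, `|f s| <= C) -> `|M f| <= C.
Proof.
move=> fC; rewrite -[leRHS]mean_cst; apply: normr_mean => //.
  exact: bounded_mapP fC.
exact: bounded_map_cst.
Qed.

End mean_theory.

(** Bessel's inequality: subtracting from [g] its projections on the first [N]
    vectors leaves [h] with
    [0 <= M (h ^+ 2) = M (g ^+ 2) - \sum_(n < N) a n ^+ 2]. *)
Lemma mean_orthonormal_cvg0 (M : (Omega -> R) -> R) (r : nat -> Omega -> R) g :
  mean M -> (forall n, bounded_map (r n)) ->
  (forall n m, M (fun s => r n s * r m s) = (n == m)%:R) ->
  bounded_map g -> M (fun s => r n s * g s) @[n --> \oo] --> 0.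
Proof.
move=> mM br rr bg; pose a n := M (fun s => r n s * g s).
have step N : exists h, [/\ bounded_map h,
    forall m, (N <= m)%N -> M (fun s => r m s * h s) = a m &
    M (fun s => h s * h s) =
      M (fun s => g s * g s) - \sum_(0 <= n < N) a n ^+ 2].
  elim: N => [|N [h [bh ah hh]]].
    by exists g; rewrite big_geq// subr0.
  have bk : bounded_map (fun s => h s - a N * r N s).
    by apply: bounded_mapB => //; exact: bounded_mapZ.
  exists (fun s => h s - a N * r N s); split=> // [m Nm|].
    have -> : (fun s => r m s * (h s - a N * r N s)) =
              (fun s => r m s * h s - a N * (r m s * r N s)).
      by apply/funext => s; ring.
    rewrite meanB//; [|exact: bounded_mapM|exact/bounded_mapZ/bounded_mapM].
    rewrite meanZ//; last exact: bounded_mapM.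
    by rewrite ah 1?ltnW// rr gtn_eqF// mulr0 subr0.
  have -> : (fun s => (h s - a N * r N s) * (h s - a N * r N s)) =
      (fun s => h s * h s -
        (2 * a N * (r N s * h s) - a N ^+ 2 * (r N s * r N s))).
    by apply/funext => s; ring.
  rewrite !(meanB mM) ?(meanZ mM);
    do ?[apply: bounded_mapB|apply: bounded_mapZ|exact: bounded_mapM].
  by rewrite hh ah// rr eqxx big_nat_recr//=; ring.
suff sa : cvgn (series (fun n => a n ^+ 2)).
  have /cvgr0Pnorm_lt a0 := cvg_series_cvg_0 sa.
  apply/cvgr0Pnorm_lt => e e0; have := a0 (e ^+ 2) ltac:(by rewrite exprn_gt0).
  apply: filterS => n; rewrite normrX ltr_pXn2r// ?nnegrE//; exact: ltW.
apply: nondecreasing_is_cvgn.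
  by apply: nondecreasing_series => n _ _; exact: sqr_ge0.
exists (M (fun s => g s * g s)) => _ [N _ <-].
have [h [bh _ hh]] := step N; rewrite /series /= -subr_ge0 -hh.
by apply: (mean_ge0 mM); [exact: bounded_mapM|move=> s; rewrite -expr2 sqr_ge0].
Qed.

(** Two functions with values in [0, 1] and independent would have a product of
    mean at least [d ^+ 2]. Correlations cannot all be below half of that: the
    sum [v] of [N] functions with pairwise correlations less than [d ^+ 2 / 2]
    would satisfy [M ((v - N * d) ^+ 2) <= N - N ^+ 2 * d ^+ 2 / 2], which is
    negative for large [N]. *)
Lemma mean_correlated (M : (Omega -> R) -> R) (W : set_system nat)
    (u : nat -> Omega -> R) (d : R) (A : set nat) :
  UltraFilter W -> mean M -> (forall n s, 0 <= u n s <= 1) ->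
  0 < d -> W [set n | d <= M (u n)] -> W A ->
  exists2 n, A n & W [set k | d ^+ 2 / 2 <= M (fun s => u n s * u k s)].
Proof.
move=> WU mM u01 d0 Wd WA; apply: contrapT => nW.
have bu n : bounded_map (u n).
  by exists 1 => s; rewrite ger0_norm; case/andP: (u01 n s).
have Wlt n : A n -> W [set k | M (fun s => u n s * u k s) < d ^+ 2 / 2].
  move=> An; have [Wn|] := in_ultra_setVsetC
      [set k | d ^+ 2 / 2 <= M (fun s => u n s * u k s)] WU.
    by exfalso; apply: nW; exists n.
  by apply: filterS => k /negP; rewrite -ltNge.
have step N : exists v : Omega -> R, [/\ bounded_map v,
    N%:R * d <= M v, M (fun s => v s * v s) <= N%:R + N%:R ^+ 2 * (d ^+ 2 / 2) &
    W [set k | M (fun s => v s * u k s) <= N%:R * (d ^+ 2 / 2)]].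
  elim: N => [|N [v [bv Mv Mvv Wv]]].
    exists (fun=> 0); split.
    - exact: bounded_map_cst.
    - by rewrite mul0r (mean_cst mM).
    - under eq_fun do rewrite mul0r.
      by rewrite (mean_cst mM)// expr0n mul0r addr0.
    - apply: filterS filterT => k _ /=.
      by under eq_fun do rewrite mul0r; rewrite (mean_cst mM) mul0r.
  have [n [[An dn] /= vn]] := filter_ex (filterI (filterI WA Wd) Wv).
  exists (fun s => v s + u n s); split.
  - exact: bounded_mapD.
  - by rewrite (meanD mM)//= -[N.+1%:R]natr1 mulrDl mul1r lerD.
  - have -> : (fun s => (v s + u n s) * (v s + u n s)) =
              (fun s => (v s * v s + 2 * (v s * u n s)) + u n s * u n s).
      by apply/funext => s; ring.
    have bvu := bounded_mapM bv (bu n).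
    rewrite !(meanD mM) ?(meanZ mM);
      do ?[apply: bounded_mapD|apply: bounded_mapZ|exact: bounded_mapM|done].
    have uu1 : M (fun s => u n s * u n s) <= 1.
      rewrite (le_trans (ler_norm _))//; apply: (normr_mean_le mM) => s.
      have /andP[u0 u1] := u01 n s.
      by rewrite ger0_norm ?mulr_ge0// mulr_ile1.
    have d20 : 0 <= d ^+ 2 / 2 by rewrite divr_ge0// sqr_ge0.
    rewrite -[N.+1%:R]natr1; lra.
  - apply: filterS (filterI Wv (Wlt n An)) => k /= [vk nk].
    under eq_fun do rewrite mulrDl.
    rewrite (meanD mM); [|exact: bounded_mapM|exact: bounded_mapM].
    rewrite -[N.+1%:R]natr1; lra.
have neg N : N%:R * (d ^+ 2 / 2) <= 1.
  case: N => [|N]; first by rewrite mul0r.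
  have [v [bv Mv Mvv _]] := step N.+1.
  have : 0 <= M (fun s => (v s - N.+1%:R * d) * (v s - N.+1%:R * d)).
    apply: (mean_ge0 mM).
      by apply: bounded_mapM; apply: bounded_mapB => //; exact: bounded_map_cst.
    by move=> s; rewrite -expr2 sqr_ge0.
  have -> : (fun s => (v s - N.+1%:R * d) * (v s - N.+1%:R * d)) =
      (fun s => (v s * v s - 2 * N.+1%:R * d * v s) + (N.+1%:R * d) ^+ 2).
    by apply/funext => s; ring.
  rewrite (meanD mM) ?(meanB mM) ?(meanZ mM) ?(mean_cst mM);
    do ?[apply: bounded_mapB|apply: bounded_mapZ|exact: bounded_mapM
        |exact: bounded_map_cst|done].
  have N0 : 0 < N.+1%:R :> R by rewrite ltr0n.
  move: (N.+1%:R) N0 Mv Mvv => x x0 Mv Mvv h.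
  rewrite -(ler_pM2l x0).
  have : x * d * M v >= x * d * (x * d) by rewrite ler_wpM2l// mulr_ge0 // ltW.
  by lra.
have d2 : 0 < d ^+ 2 / 2 by rewrite divr_gt0 ?exprn_gt0.
have := archi_boundP (ltW (divr_gt0 ltr01 d2)); rewrite ltr_pdivrMr//.
by move=> /lt_le_trans /(_ (neg _)); rewrite ltxx.
Qed.

End means.

Section chain.
Context (R : realType) (Omega : Type).

Lemma mean_indic_gt0 (M : (Omega -> R) -> R) (A : set Omega) :
  mean M -> 0 < M (\1_A) -> A !=set0.
Proof.
move=> mM; apply: contraPP => /set0P/negP/negPn/eqP->.
rewrite (_ : \1_set0 = fun=> 0) ?(mean_cst mM) ?ltxx//.
by apply/funext => s; rewrite indicE in_set0.
Qed.

(** The set [Q] of points admissible so far keeps intersections with [W]-many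
    [S k] of mean bounded below; by [mean_correlated] this persists when [Q] is
    intersected with a suitable [S n]. A point [s] of the new [Q] is chosen, and
    further indices are restricted to [B s]. *)
Lemma mean_chain (M : (Omega -> R) -> R) (W : set_system nat)
    (S : nat -> set Omega) (B : Omega -> set nat) (d : R) :
  UltraFilter W -> mean M -> 0 < d -> W [set k | d <= M (\1_(S k))] ->
  (forall s, W (B s)) ->
  exists (n : nat -> nat) (s : nat -> Omega),
    (forall i j, (i <= j)%N -> S (n i) (s j)) /\
    (forall i j, (j < i)%N -> B (s j) (n i)).
Proof.
move=> WU mM d0 Wd WB.
pose good (Q : set Omega) :=
  exists2 e, 0 < e & W [set k | e <= M (\1_(Q `&` S k))].
have good_next Q A : good Q -> W A -> exists2 n, A n & good (Q `&` S n).
  move=> [e e0 We] WA.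
  have [|n An Wn] :=
    mean_correlated WU mM (u := fun n => \1_(Q `&` S n)) _ e0 We WA.
    by move=> n s; rewrite indicE; case: (_ \in _); rewrite ?lexx ler01.
  exists n => //; exists (e ^+ 2 / 2); first by rewrite divr_gt0 ?exprn_gt0.
  apply: filterS Wn => k /=; congr (_ <= M _).
  apply/funext => s; rewrite !indicE !in_setI.
  by case: (s \in Q); case: (s \in S n); case: (s \in S k);
    rewrite /= ?mulr1 ?mulr0.
have good_ex Q : good Q -> Q !=set0.
  move=> [e e0 /filter_ex[k /(lt_le_trans e0)/(mean_indic_gt0 mM)]].
  by move=> [s [Qs _]]; exists s.
have goodT : good setT.
  by exists d => //; under eq_set do rewrite setTI.
have [s0 _] := good_ex _ goodT.
(* A state consists of the set [Q] of points and the set [A] of indices that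
   remain admissible, and of the last choices of an index and a point. *)
pose T := {x : set Omega * set nat * (nat * Omega) | good x.1.1 /\ W x.1.2}.
pose next (x y : T) := let: (Q, A, _) := sval x in
  let: (Q', A', (n, s)) := sval y in
  [/\ A n, Q' `<=` Q `&` S n, Q' s & A' `<=` A `&` B s].
have nextP (x : T) : {y : T | next x y}.
  apply: cid; case: x => -[[Q A] ns] /= [gQ WA].
  have [n An gQn] := good_next _ _ gQ WA.
  have [s Qs] := good_ex _ gQn.
  have yP : good (Q `&` S n) /\ W (A `&` B s).
    by split=> //; exact: filterI.
  by exists (exist _ (Q `&` S n, A `&` B s, (n, s)) yP); split.
have x0P : good setT /\ W setT by split=> //; exact: filterT.
have [f [f0 fS]] := dependent_choice nextP
  (exist _ (setT, setT, (0%N, s0)) x0P : T).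
pose Q i := (sval (f i)).1.1; pose A i := (sval (f i)).1.2.
pose n i := (sval (f i.+1)).2.1; pose s i := (sval (f i.+1)).2.2.
have step i : [/\ A i (n i), Q i.+1 `<=` Q i `&` S (n i), Q i.+1 (s i) &
    A i.+1 `<=` A i `&` B (s i)].
  have := fS i; rewrite /next /Q /A /n /s.
  by case: (sval (f i)) => -[? ?] ?; case: (sval (f i.+1)) => -[? ?] [? ?].
have Qmono i k : Q (k + i)%N `<=` Q i.
  elim: k => // k IHk; have [_ QS _ _] := step (k + i)%N.
  by apply: subset_trans IHk => t /QS[].
have Amono i k : A (k + i)%N `<=` A i.
  elim: k => // k IHk; have [_ _ _ AS] := step (k + i)%N.
  by apply: subset_trans IHk => t /AS[].
exists n, s; split=> i j ij.
  have [_ _ Qs _] := step j; have [_ QS _ _] := step i.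
  suff /QS[] : Q i.+1 (s j) by [].
  by apply: (Qmono _ (j - i)%N); rewrite addnS subnK.
have [An _ _ _] := step i; have [_ _ _ AS] := step j.
suff /AS[] : A j.+1 (n i) by [].
by apply: (Amono _ (i - j.+1)%N); rewrite subnK.
Qed.

End chain.

(** * Orthonormal sequences against functions with commuting iterated limits *)

Section interchange.
Context (R : realType) (Omega : Type) (W : set_system nat).
Context (WU : UltraFilter W) (Woo : \oo `<=` W).
Local Notation ulim := (ulim W).

(** Grothendieck's double limit criterion for weak compactness of the functions
    [H n], with all limits taken along one ultrafilter. *)
Definition iterated_limits_commute (H : nat -> Omega -> R) :=
  forall (n : nat -> nat) (s : nat -> Omega),
    ulim (fun j => ulim (fun i => H (n j) (s i))) =
    ulim (fun i => ulim (fun j => H (n j) (s i))).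

(** The functions [H n] form a weakly compact set in the sense of the double
    limit criterion, and the claim is that an orthonormal bounded sequence tends
    to [0] uniformly on such a set. If not, [mean_chain] applied to the
    differences with their pointwise limit produces iterated limits that differ
    by at least [e / 8]. *)
Lemma orthonormal_iterated_limits_cvg0 (M : (Omega -> R) -> R)
    (r H : nat -> Omega -> R) (C : R) :
  mean M -> (forall n s, `|r n s| <= 1) ->
  (forall n m, M (fun s => r n s * r m s) = (n == m)%:R) ->
  (forall n s, `|H n s| <= C) -> iterated_limits_commute H ->
  M (fun s => r n s * H n s) @[n --> \oo] --> 0.
Proof.
move=> mM r1 rr HC0 HH; apply/cvgr0Pnorm_lt => e e0; apply: contrapT => nlt.
wlog C0 : C HC0 / 0 < C.
  move=> /(_ (`|C| + 1)); apply; last by rewrite ltr_wpDl.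
  by move=> n s; rewrite (le_trans (HC0 n s))// (le_trans (ler_norm _))// lerDl.
have HC := HC0.
have far (N : nat) : {n | (N <= n)%N & e <= `|M (fun s => r n s * H n s)|}.
  apply: cid2; apply: contrapT => nN; apply: nlt; exists N => // n /= Nn.
  by rewrite ltNge; apply/negP => en; apply: nN; exists n.
pose sg N := s2val (far N).
have sgN N : (N <= sg N)%N by rewrite /sg; case: (far N).
have sge N : e <= `|M (fun s => r (sg N) s * H (sg N) s)|.
  by rewrite /sg; case: (far N).
have br n : bounded_map (r n) by exact: bounded_mapP (r1 n).
have bH n : bounded_map (H n) by exact: bounded_mapP (HC n).
pose Hoo s := ulim (fun k => H (sg k) s).
have HooC s : `|Hoo s| <= C by exact: normr_ulim_le.
have bHoo : bounded_map Hoo by exact: bounded_mapP HooC.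
pose Z k s := H (sg k) s - Hoo s.
have bZ k : bounded_map (Z k) by exact: bounded_mapB.
have ZC k s : `|Z k s| <= 2 * C.
  by rewrite (le_trans (ler_normB _ _))// mulrDl mul1r lerD.
have Z0 s : Z k s @[k --> W] --> 0.
  rewrite -(subrr (Hoo s)); apply: cvgB; last exact: cvg_cst.
  by apply: ulim_cvg; exists C => k; exact: HC.
pose S k := [set s | e / 4 <= `|Z k s|].
(* [`|Z k| <= 2 * C * \1_(S k) + e / 4] has mean at least [e / 2] *)
pose d := e / (8 * C).
have d0 : 0 < d by rewrite divr_gt0// mulr_gt0.
have WS : W [set k | d <= M (\1_(S k))].
  have /cvgr0Pnorm_lt/(_ (e / 2) ltac:(by rewrite divr_gt0))[N _ rHoo] :=
    mean_orthonormal_cvg0 mM br rr bHoo.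
  apply: Woo; exists N => // k /= Nk.
  have {}rHoo := rHoo (sg k) (leq_trans Nk (sgN k)).
  have brZ : bounded_map (fun s => r (sg k) s * Z k s) by exact: bounded_mapM.
  have e2 : e / 2 <= M (fun s => `|Z k s|).
    have : M (fun s => r (sg k) s * H (sg k) s) =
        M (fun s => r (sg k) s * Z k s) + M (fun s => r (sg k) s * Hoo s).
      rewrite -(meanD mM)//; last exact: bounded_mapM.
      by congr M; apply/funext => s; rewrite /Z; ring.
    have := sge k => /[swap] ->; have := ler_normD
      (M (fun s => r (sg k) s * Z k s)) (M (fun s => r (sg k) s * Hoo s)).
    have : `|M (fun s => r (sg k) s * Z k s)| <= M (fun s => `|Z k s|).
      apply: (normr_mean mM) => //; first exact: bounded_map_norm.
      by move=> s; rewrite normrM ler_piMl.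
    by move: rHoo => /=; lra.
  have : M (fun s => `|Z k s|) <= M (fun s => (2 * C) * \1_(S k) s + e / 4).
    apply: (le_mean mM); first exact: bounded_map_norm.
      apply: bounded_mapD; last exact: bounded_map_cst.
      by apply: bounded_mapZ; exact: bounded_map_indic.
    move=> s; rewrite indicE; have [/set_mem sS|/negP sS] := boolP (s \in S k).
      by rewrite mulr1 (le_trans (ZC k s))// lerDl divr_ge0// ltW.
    rewrite mulr0 add0r ltW// ltNge; apply/negP => h; apply: sS.
    exact: mem_set.
  rewrite (meanP mM); [|exact: bounded_map_indic|exact: bounded_map_cst].
  rewrite (mean_cst mM) /d ler_pdivrMr ?mulr_gt0//; lra.
pose B s := [set k | `|Z k s| < e / 8].
have WB s : W (B s).
  by have /cvgr0Pnorm_lt := Z0 s; apply; rewrite divr_gt0.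
have [n [s [nS nB]]] := mean_chain WU mM d0 WS WB.
have := HH (sg \o n) s => /=.
set L1 := ulim _; set L2 := ulim _ => L12.
pose G := ulim (Hoo \o s).
have cG : Hoo \o s @ W --> G by apply: ulim_cvg; exists C => i /=.
have L2G : `|L2 - G| <= e / 8.
  have cL2 : (fun i => ulim (fun j => H (sg (n j)) (s i))) @ W --> L2.
    by apply: ulim_cvg; exists C => i; exact: normr_ulim_le.
  apply: (cvgr_to_le (cvg_norm (cvgB cL2 cG))).
  apply: filterS filterT => i _ /=.
  have cL : H (sg (n j)) (s i) @[j --> W] -->
      ulim (fun j => H (sg (n j)) (s i)).
    by apply: ulim_cvg; exists C => j.
  apply: (cvgr_to_le (cvg_norm (cvgB cL (cvg_cst (Hoo (s i)))))).
  apply: Woo; exists i.+1 => // j /= ij; exact/ltW/nB.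
have L1G : e / 4 <= `|L1 - G|.
  have cL1 : (fun j => ulim (fun i => H (sg (n j)) (s i))) @ W --> L1.
    by apply: ulim_cvg; exists C => i; exact: normr_ulim_le.
  apply: (cvgr_to_ge (cvg_norm (cvgB cL1 (cvg_cst G)))).
  apply: filterS filterT => j _ /=.
  have cL : H (sg (n j)) (s i) @[i --> W] -->
      ulim (fun i => H (sg (n j)) (s i)).
    by apply: ulim_cvg; exists C => i.
  apply: (cvgr_to_ge (cvg_norm (cvgB cL cG))).
  by apply: Woo; exists j => // i /= ij; exact: nS.
by move: L2G L1G; rewrite L12; lra.
Qed.

End interchange.

(** * Uniform boundedness *)

Section uniform_boundedness.
Context (R : realType) (W : set_system nat).
Context (WU : UltraFilter W) (Woo : \oo `<=` W).
Context (V : lmodType R) (p : V -> R) (I : Type) (F : I -> {linear V -> R^o}).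
Hypothesis Fp : forall i v, `|F i v| <= p v.

Lemma almost_norming (v : V) (C : R) i0 : 0 <= C -> C < `|F i0 v| ->
  exists2 i, C < `|F i v| & forall j, `|F j v| <= 4 / 3 * `|F i v|.
Proof.
move=> C0 CF; pose A := [set `|F i v : R| | i in [set: I]].
have sA : has_sup A.
  split; first by exists `|F i0 v|, i0.
  by exists (p v) => _ [i _ <-]; exact: Fp.
have Fsup i : `|F i v : R| <= sup A.
  by apply: sup_upper_bound => //; exists i.
have [big|small] := leP (3 / 4 * sup A) `|F i0 v|.
  exists i0 => // j; rewrite (le_trans (Fsup j))//; lra.
have s0 : 0 < sup A by rewrite (le_lt_trans C0)// (lt_le_trans CF).
have [_ [i _ <-] iA] := sup_adherent (divr_gt0 s0 (ltr0n R 4)) sA.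
by exists i => [|j]; [|have := Fsup j]; move: iA small CF; rewrite /=; lra.
Qed.

(** A gliding hump: given [F (i k)] almost norming at [z (n k)] with a huge
    value, the signs in [\sum_k (+/-) 3^-k * F (i k)] are chosen one after the
    other so that no partial sum loses the size of its last term at [z (n k)].
    The later terms amount to at most [2 / 3] of it: the geometric series gives
    [1 / 2], and almost norming costs a factor [4 / 3]. *)
Lemma equicontinuous_uniform_bound (z : nat -> V) :
  (forall G : {linear V -> R^o}, (exists c, forall v, `|G v| <= c * p v) ->
     exists C, forall n, `|G (z n)| <= C) ->
  exists C, forall i n, `|F i (z n)| <= C.
Proof.
move=> zb; apply: contrapT => nC.
have /choice[ni niP] (k : nat) : exists ni : nat * I,
    3 ^+ k.+1 * k%:R < `|F ni.2 (z ni.1)| /\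
    forall j, `|F j (z ni.1)| <= 4 / 3 * `|F ni.2 (z ni.1)|.
  have K0 : 0 <= 3 ^+ k.+1 * k%:R :> R by rewrite mulr_ge0// exprn_ge0.
  apply: contrapT => nk; apply: nC; exists (3 ^+ k.+1 * k%:R) => i n.
  rewrite leNgt; apply/negP => h; apply: nk.
  by have [j j1 j2] := almost_norming K0 h; exists (n, j).
pose f k v : R := F (ni k).2 v; pose y k := z (ni k).1.
pose G := fix G k v : R := if k is k'.+1 then
  let x := 3 ^- k' * f k' (y k') in
  let sgn := if `|x| <= `|G k' (y k') + x| then 1 else -1 in
  G k' v + sgn * (3 ^- k' * f k' v) else 0.
have GS k : exists sgn : R, [/\ `|sgn| = 1,
    forall v, G k.+1 v = G k v + sgn * (3 ^- k * f k v) &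
    3 ^- k * `|f k (y k)| <= `|G k.+1 (y k)|].
  have x3 : 3 ^- k * `|f k (y k)| = `|3 ^- k * f k (y k)|.
    by rewrite normrM ger0_norm// invr_ge0 exprn_ge0.
  rewrite x3 /=; set x := 3 ^- k * f k (y k); set a := G k (y k).
  case: ifPn => [ax|ax].
    by exists 1; split=> //; rewrite ?normr1 ?mul1r.
  exists (-1); split=> //; first by rewrite normrN1.
  move: ax; rewrite -ltNge mulN1r; case: (ger0P x); case: (ger0P (a + x));
    case: (ger0P (a - x)); lra.
have Glin k : linear (G k : V -> R^o).
  elim: k => [|k IHk] a v w; first by rewrite scaler0 addr0.
  have [sgn [_ E _]] := GS k; rewrite !E IHk /f linearP /=.
  rewrite -[a *: _]/(a * _) -[a *: F _ v]/(a * F _ v).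
  rewrite -[a *: (_ + _)]/(a * (_ + _)); ring.
have Gcauchy v Q : (forall i, `|F i v| <= Q) -> forall k m,
    `|G (m + k)%N v - G k v| <= 3 / 2 * (3 ^- k - 3 ^- (m + k)) * Q.
  move=> FQ k; elim=> [|m IHm]; first by rewrite !subrr normr0 mulr0 mul0r.
  have [sgn [s1 E _]] := GS (m + k)%N.
  have h3 : 3 ^- (m + k).+1 = 3^-1 * 3 ^- (m + k) :> R.
    by rewrite exprS invfM.
  have fQ : `|sgn * (3 ^- (m + k) * f (m + k)%N v)| <= 3 ^- (m + k) * Q.
    rewrite !normrM s1 mul1r ger0_norm ?invr_ge0 ?exprn_ge0//.
    by rewrite ler_wpM2l ?invr_ge0 ?exprn_ge0//; exact: FQ.
  rewrite addSn E h3 addrAC (le_trans (ler_normD _ _))//.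
  by move: IHm fQ; lra.
have {}Gcauchy v Q : (forall i, `|F i v| <= Q) -> forall k m,
    `|G (m + k)%N v - G k v| <= 3 / 2 * 3 ^- k * Q.
  move=> FQ k m; rewrite (le_trans (Gcauchy v Q FQ k m))//.
  have Q0 : 0 <= Q by exact: le_trans (FQ (ni 0%N).2).
  rewrite ler_wpM2r// ler_wpM2l// gerBl invr_ge0 exprn_ge0//.
have Gp k v : `|G k v| <= 3 / 2 * p v.
  have := Gcauchy v (p v) (Fp^~ v) 0%N k.
  by rewrite addn0 subr0 expr0 invr1 mulr1.
have bG v : bounded_map (G^~ v) by exact: bounded_mapP (Gp^~ v).
pose Gooh v : R^o := ulim W (G^~ v).
have lGoo : linear Gooh by exact: ulim_linear.
pose Goo : {linear V -> R^o} := HB.pack Gooh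
  (GRing.isLinear.Build R V R^o *:%R Gooh lGoo).
have [|C GC] := zb Goo.
  by exists (3 / 2) => v; exact: normr_ulim_le.
pose k := Num.bound (Num.max C 0).
have Ck : C < k%:R.
  have := archi_boundP (_ : 0 <= Num.max C 0).
  rewrite le_max lexx orbT => /(_ isT).
  by apply: le_lt_trans; rewrite le_max lexx.
have [sgn [_ _ big]] := GS k.
have [lb norming] := niP k.
have close :
    `|Goo (y k) - G k.+1 (y k)| <= 3 / 2 * 3 ^- k.+1 * (4 / 3 * `|f k (y k)|).
  have cG := ulim_cvg WU (bG (y k)).
  apply: (cvgr_to_le (cvg_norm (cvgB cG (cvg_cst (G k.+1 (y k)))))).
  apply: Woo; exists k.+1 => // m /= km.
  by rewrite -(subnK km); exact: Gcauchy.
have h3 : 3 ^- k.+1 = 3^-1 * 3 ^- k :> R by rewrite exprS invfM.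
have h : k%:R <= 3 ^- k.+1 * `|f k (y k)|.
  by rewrite mulrC ler_pdivlMr ?exprn_gt0// mulrC ltW.
have := ler_normB (Goo (y k)) (Goo (y k) - G k.+1 (y k)).
rewrite opprB addrC subrK; move: (GC (ni k).1) Ck.
rewrite -/(y k); move: h close big; rewrite h3; lra.
Qed.

End uniform_boundedness.

(** * The mean over sign sequences *)

Section sign_sequences.
Context (R : realType).
Implicit Types (g h : seq bool -> R) (s : seq bool).

(** The [n]-th sign of [s], and [0] beyond the end of [s]: a sign sequence then
    involves finitely many coordinates of [l1]. *)
Definition rademacher n s : R := [seq (-1) ^+ (b : bool) | b <- s]`_n.

Fixpoint sign_average N g : R := if N is N'.+1 then
  (sign_average N' (fun s => g (false :: s)) +
   sign_average N' (fun s => g (true :: s))) / 2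
  else g [::].

Lemma normr_rademacher_le1 n s : `|rademacher n s| <= 1.
Proof.
elim: s n => [|b s IHs] [|n] //=; rewrite /rademacher ?nth_nil ?normr0//=.
  by rewrite normrX normrN1 expr1n.
exact: IHs.
Qed.

Lemma sign_averageP N a g h :
  sign_average N (fun s => a * g s + h s) =
  a * sign_average N g + sign_average N h.
Proof.
elim: N g h => //= N IHN g h; rewrite !(IHN (fun s => g (_ :: s))).
by field.
Qed.

Lemma sign_average_cst N c : sign_average N (fun=> c) = c.
Proof. by elim: N => //= N ->; field. Qed.

Lemma sign_average_ge0 N g : (forall s, 0 <= g s) -> 0 <= sign_average N g.
Proof.
by elim: N g => //= N IHN g g0; rewrite divr_ge0// addr_ge0// IHN.
Qed.

Lemma normr_sign_average_le N g C : (forall s, `|g s| <= C) ->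
  `|sign_average N g| <= C.
Proof.
elim: N g => //= N IHN g gC; rewrite normrM [X in _ * X]ger0_norm ?invr_ge0//.
rewrite ler_pdivrMr// mulr_natr mulr2n (le_trans (ler_normD _ _))//.
by rewrite lerD// IHN.
Qed.

Lemma sign_average_rademacher N n : sign_average N (rademacher n) = 0.
Proof.
elim: N n => [|N IHN] [|n] //=; first by rewrite !sign_average_cst; field.
by rewrite !IHN addr0 mul0r.
Qed.

Lemma sign_average_orthonormal N n m : (maxn n m < N)%N ->
  sign_average N (fun s => rademacher n s * rademacher m s) = (n == m)%:R.
Proof.
elim: N n m => // N IHN [|n] [|m] nmN /=.
- by rewrite /rademacher /= !sign_average_cst; field.
- have E c : sign_average N (fun s => c * rademacher m s) = 0.
    have := sign_averageP N c (rademacher m) (fun=> 0).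
    rewrite sign_average_rademacher sign_average_cst mulr0 addr0 => <-.
    by congr sign_average; apply/funext => s; rewrite addr0.
  by rewrite /rademacher /= !E addr0 mul0r.
- have E c : sign_average N (fun s => rademacher n s * c) = 0.
    have := sign_averageP N c (rademacher n) (fun=> 0).
    rewrite sign_average_rademacher sign_average_cst mulr0 addr0 => <-.
    by congr sign_average; apply/funext => s; rewrite addr0 mulrC.
  by rewrite /rademacher /= !E addr0 mul0r.
- have {}IHN := IHN n m; rewrite /rademacher /= IHN; last first.
    by move: nmN; rewrite maxnSS ltnS.
  by rewrite eqSS; field.
Qed.

Context (W : set_system nat) (WU : UltraFilter W) (Woo : \oo `<=` W).

Definition sign_mean g : R := ulim W (fun N => sign_average N g).

Lemma bounded_sign_average g : bounded_map g ->
  bounded_map (fun N => sign_average N g).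
Proof. by move=> [C gC]; exists C => N; exact: normr_sign_average_le. Qed.

Lemma sign_meanP : mean sign_mean.
Proof.
split=> [a g h bg bh|g bg g0|].
- rewrite -ulimP//; try exact: bounded_sign_average.
  by congr (ulim W _); apply/funext => N; rewrite sign_averageP.
- apply: (cvgr_to_ge (ulim_cvg WU (bounded_sign_average bg))).
  by apply: filterS filterT => N _; exact: sign_average_ge0.
- apply: ulimE; under eq_fun do rewrite sign_average_cst.
  exact: cvg_cst.
Qed.

Lemma sign_mean_orthonormal n m :
  sign_mean (fun s => rademacher n s * rademacher m s) = (n == m)%:R.
Proof.
apply: ulimE; apply: cvg_near_cst; apply: Woo; exists (maxn n m).+1 => // N /=.
by move=> nmN; exact: sign_average_orthonormal.
Qed.

End sign_sequences.

(** * Functionals on a space containing l1 *)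

Section l1_copy.
Context (R : realType).
Implicit Types (x : l1 R) (s : seq bool).

Lemma sum_unit_le1 (n N : nat) :
  \sum_(0 <= k < N) `|(k == n)%:R : R| <= 1.
Proof.
under eq_bigr do rewrite normr_nat.
have [nN|Nn] := ltnP n N.
  rewrite big_mkord (bigD1 (Ordinal nN))//= eqxx big1 ?addr0// => i.
  by rewrite -val_eqE /= => /negbTE ->.
rewrite big_nat_cond big1 ?ler01// => i; rewrite andbT => /andP[_ iN].
by rewrite ltn_eqF// (leq_trans iN).
Qed.

Lemma unit_sequence_summable (n : nat) :
  (fun k => (k == n)%:R : R^o) \in @absolutely_summable R.
Proof.
rewrite inE /absolutely_summable /=; apply: nondecreasing_is_cvgn.
  by apply: nondecreasing_series.
by exists 1 => _ [N _ <-]; exact: sum_unit_le1.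
Qed.

Definition l1_unit (n : nat) : l1 R :=
  exist (fun u : nat -> R^o => u \in @absolutely_summable R) _
    (unit_sequence_summable n).

Lemma partial_sum_le_l1_norm x N :
  \sum_(0 <= n < N) `|(\val x : nat -> R^o) n : R| <= `|x|.
Proof.
have cx : cvgn (series (fun n => `|(\val x : nat -> R^o) n| : R)).
  exact: set_mem (valP x).
have ndx : nondecreasing_seq (series (fun n => `|(\val x : nat -> R^o) n| : R)).
  by apply: nondecreasing_series => i _ _.
exact: (nondecreasing_cvgn_le ndx cx N).
Qed.

Lemma norm_l1_unit n : `|l1_unit n : l1 R| <= 1.
Proof.
apply: limr_le; first exact: set_mem (valP (l1_unit n)).
by apply: filterS filterT => N _; exact: sum_unit_le1.
Qed.

Definition sign_functional s x : R^o :=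
  \sum_(0 <= n < size s) rademacher R n s * (\val x : nat -> R^o) n.

Lemma sign_functional_linear s : linear (sign_functional s).
Proof.
move=> a x y; rewrite /sign_functional scaler_sumr -big_split.
apply: eq_bigr => n _ /=.
by rewrite /GRing.scale /= mulrDr mulrCA.
Qed.

HB.instance Definition _ s :=
  GRing.isLinear.Build R (l1 R) R^o *:%R (sign_functional s)
    (@sign_functional_linear s).

Lemma sign_functional_le_norm s x : sign_functional s x <= `|x|.
Proof.
apply: le_trans (partial_sum_le_l1_norm x (size s)).
apply: ler_sum => n _; rewrite (le_trans (ler_norm _))// normrM.
by rewrite ler_piMl// normr_rademacher_le1.
Qed.

Lemma sign_functional_unit s n :
  sign_functional s (l1_unit n) = rademacher R n s.
Proof.
rewrite /sign_functional /=; have [ns|sn] := ltnP n (size s).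
  rewrite big_mkord (bigD1 (Ordinal ns))//= eqxx mulr1 big1 ?addr0// => i.
  by rewrite -val_eqE /= => /negbTE ->; rewrite mulr0.
rewrite /rademacher nth_default ?size_map//.
rewrite big_nat_cond big1// => i; rewrite andbT => /andP[_ iN].
by rewrite ltn_eqF ?mulr0// (leq_trans iN).
Qed.

Context (E : tvsType R).

(** A seminorm [p] with [`|x| <= p (T x)] exists because [S] is continuous at
    [0]; it dominates all sign functionals at once on the range of [T]. *)
Lemma l1_copy_functionals : contains_copy E (l1 R) ->
  exists (e : nat -> E) (p : E -> R) (F : seq bool -> {linear E -> R^o}),
    [/\ continuous_seminorm p, forall s v, `|F s v| <= p v,
        forall s n, F s (e n) = rademacher R n s &
        forall G : {linear E -> R^o}, continuous (G : E -> R^o) ->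
          bounded_map (fun n => G (e n) : R)].
Proof.
move=> [A [_ [T [S [AT TS ST cT cS]]]]].
have [U U0 US] : exists2 U, nbhs (0 : E) U &
    forall x, U (T x) -> `|x| < 1.
  have A0 : A 0 by rewrite -(linear0 T).
  have : S @ within A (nbhs 0) --> S 0 by move/subspace_continuousP : cS; apply.
  have -> : S 0 = 0 by rewrite -(linear0 T) TS.
  move=> /cvgr0Pnorm_lt/(_ 1 ltr01) SU.
  exists [set v | A v -> `|S v| < 1]; first exact: SU.
  by move=> x /(_ (AT x)); rewrite TS.
have [p cp pU] := exists_continuous_seminorm U0.
have sp := cp.1.
have normp x : `|x| <= p (T x).
  rewrite leNgt; apply/negP => px.
  have x0 : 0 < `|x| by exact: le_lt_trans (seminorm_ge0 _ sp) px.
  have : p (T (`|x|^-1 *: x)) < 1.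
    rewrite linearZ sp.2 ger0_norm ?invr_ge0//.
    by rewrite mulrC ltr_pdivrMr// mul1r.
  move=> /pU/US; rewrite normrZ ger0_norm ?invr_ge0// mulVf ?gt_eqF//.
  by rewrite ltxx.
have /choice[F FP] s : exists F : {linear E -> R^o},
    (forall x, F (T x) = sign_functional s x) /\ forall v, F v <= p v.
  apply: hahn_banach; first exact: seminorm_sublinear.
  by move=> x; exact: le_trans (sign_functional_le_norm s x) (normp x).
exists (fun n => T (l1_unit n)), p, F; split=> //.
- by move=> s v; apply: le_seminorm_norm => //; exact: (FP s).2.
- by move=> s n; rewrite (FP s).1 sign_functional_unit.
move=> G cG.
have : G \o T @ (0 : l1 R) --> G (T 0).
  by apply: continuous_comp; [exact: cT|exact: cG].
rewrite !linear0 => /cvgr0Pnorm_lt/(_ 1 ltr01).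
rewrite -nbhs_ballE => -[d /= d0 dG].
exists (d / 2)^-1 => n.
have : ball (0 : l1 R) d ((d / 2) *: l1_unit n).
  rewrite -ball_normE /ball_ /= sub0r normrN normrZ.
  rewrite ger0_norm ?divr_ge0 ?(ltW d0)//.
  have := norm_l1_unit n; nra.
move=> /dG /=; rewrite !linearZ normrM ger0_norm ?divr_ge0 ?(ltW d0)// => h.
by rewrite -[leRHS]mul1r ler_pdivlMr ?divr_gt0// mulrC ltW.
Qed.

End l1_copy.

(** * Coefficient functionals along weakly continuous functions *)

Section weak_continuity.
Context (R : realType) (X : topologicalType) (E : tvsType R).

Lemma weak_continuousP (h : X -> weak E) : continuous h <->
  forall G : {linear E -> R^o}, continuous (G : E -> R^o) ->
    continuous (fun x => G (h x) : R^o).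
Proof.
split=> [ch G cG x|hG x].
  exact: ((cvg_weakP _ _).1 (ch x) (exist _ G cG)).
by apply: ((@cvg_weakP R E (h @ x) (h x) _).2) => -[G cG]; exact: (hG G cG x).
Qed.

End weak_continuity.

Section null_functionals.
Context (R : realType) (E : tvsType R).
Context (W : set_system nat) (WU : UltraFilter W) (Woo : \oo `<=` W).
Context (p : E -> R) (F : seq bool -> {linear E -> R^o}).
Hypothesis cp : continuous_seminorm p.
Hypothesis Fp : forall s v, `|F s v| <= p v.

(** The [n]-th coordinate of the image of [v] under an extension to [E] of the
    natural map from [l1] to [l2]. *)
Definition coefficient (n : nat) (v : E) : R^o :=
  sign_mean W (fun s => rademacher R n s * F s v).

Let bounded_coefficient n v :
  bounded_map (fun s => rademacher R n s * F s v : R).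
Proof.
exists (p v) => s; rewrite normrM -[leRHS]mul1r ler_pM//.
exact: normr_rademacher_le1.
Qed.

Lemma coefficient_linear n : linear (coefficient n).
Proof.
move=> a v w; rewrite /coefficient -[RHS](meanP (sign_meanP R WU))//.
congr (sign_mean W _); apply/funext => s.
rewrite linearP mulrDr; congr (_ + _).
by rewrite /GRing.scale /= mulrCA.
Qed.

HB.instance Definition _ n :=
  GRing.isLinear.Build R E R^o *:%R (coefficient n) (@coefficient_linear n).

Lemma coefficient_continuous n : continuous (coefficient n).
Proof.
apply: (dominated_continuous (F := coefficient n) (c := 1) cp) => v.
rewrite mul1r; apply: (normr_mean_le (sign_meanP R WU)) => s.
rewrite normrM -[leRHS]mul1r ler_pM//; exact: normr_rademacher_le1.
Qed.

(** The functionals dominated by [p] form a weak-star compact set. *)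
Lemma ulim_dominated (s : nat -> seq bool) :
  exists2 G : {linear E -> R^o}, continuous (G : E -> R^o) &
    forall v, F (s i) v @[i --> W] --> G v.
Proof.
have bF v : bounded_map (fun i => F (s i) v : R).
  by exists (p v) => i; exact: Fp.
pose G (v : E) : R^o := ulim W (fun i => F (s i) v).
have lG : linear G.
  by apply: (ulim_linear WU bF) => i; exact: linearP.
pose G' : {linear E -> R^o} :=
  HB.pack G (GRing.isLinear.Build R E R^o *:%R G lG).
exists G'; last by move=> v; exact: ulim_cvg.
apply: (dominated_continuous (c := 1) cp) => v.
by rewrite mul1r; apply: normr_ulim_le => i; exact: Fp.
Qed.

(** For sequences [n] and [s], both iterated limits of [F (s i) (h (t (n j)))]
    are [G (h x)], with [x] the limit of [t \o n] in [K] and [G] the limit of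
    [F \o s] in the dual of [E]. *)
Lemma coefficient_cvg0 (X : topologicalType) (K : set X) (h : X -> weak E)
    (t : nat -> X) : compact K -> continuous h -> (forall n, K (t n)) ->
  coefficient n (h (t n)) @[n --> \oo] --> (0 : R^o).
Proof.
move=> cK /weak_continuousP hG Kt.
have [|C HC] := @equicontinuous_uniform_bound R W WU Woo E p _ F Fp
    (fun n => h (t n)).
  move=> G [c Gc]; have cG := dominated_continuous cp Gc.
  have : compact [set (G (h x) : R^o) | x in K].
    by apply: continuous_compact => //; apply: continuous_subspaceT; exact: hG.
  move=> /compact_bounded[C [_ /(_ (C + 1))]].
  rewrite ltrDl ltr01 => /(_ isT) GC.
  by exists (C + 1) => n; apply: GC; exists (t n).
apply: (orthonormal_iterated_limits_cvg0 WU Woo (sign_meanP R WU)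
    (H := fun n s => F s (h (t n))) (C := C)).
- exact: normr_rademacher_le1.
- exact: sign_mean_orthonormal.
- by move=> n s; exact: HC.
move=> n s; have [G cG FG] := ulim_dominated s.
have [x Kx tx] := ultra_compact_cvg WU cK (fun j => Kt (n j)).
rewrite (_ : (fun j => _) = fun j => G (h (t (n j)))); last first.
  by apply/funext => j; apply: ulimE; exact: FG.
rewrite [RHS](_ : _ = ulim W (fun i => F (s i) (h x))).
  rewrite (ulimE _ (FG (h x))); apply: ulimE.
  exact: (cvg_comp _ _ tx (hG G cG x)).
congr ulim; apply/funext => i; apply: ulimE.
apply: (cvg_comp _ _ tx (hG (F (s i)) _ x)).
by apply: (dominated_continuous (c := 1) cp) => v; rewrite mul1r.
Qed.

End null_functionals.

(** * Disjoint bumps around points of an infinite set *)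

Section bumps.
Context (R : realType) (X : topologicalType).

Lemma exists_bump (O : set X) a : completely_regular_space X -> open O -> O a ->
  exists psi : X -> R, [/\ continuous psi, forall x, 0 <= psi x <= 1,
    psi a = 1 & forall x, psi x != 0 -> O x].
Proof.
move=> crX oO Oa.
have /(@uniform_separatorP _ R)[f [cf f01 fa fO]] :
    uniform_separator [set a] (~` O).
  by apply: crX; [exact: open_closedC|move=> /(_ Oa)].
exists (fun x => 1 - f x); split.
- by move=> x; apply: cvgB; [exact: cvg_cst|exact: cf].
- move=> x; have : range f (f x) by exists x.
  by move=> /f01; rewrite /= in_itv /= => /andP[f0 f1]; apply/andP; split; lra.
- have -> : f a = 0 by apply: fa; exists a.
  by rewrite subr0.
- move=> x; apply: contraPP => Ox; have -> : f x = 1 by apply: fO; exists x.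
  by rewrite subrr eqxx.
Qed.

(** A continuous function separates two points of [K `&` O]. One of its strict
    sublevel or superlevel sets [f < 2 / 3] and [f > 1 / 3], which cover the
    space, still has infinitely many points of [K `&` O]; the bump is put at the
    point on the other side. *)
Lemma exists_bump_leaving_infinite (K O : set X) : tychonoff_space X ->
  open O -> infinite_set (K `&` O) ->
  exists (t : X) (psi : X -> R) (P : set X),
    [/\ K t, continuous psi, forall x, 0 <= psi x <= 1, psi t = 1 &
        [/\ open P, infinite_set (K `&` P), P `<=` O &
            forall x, psi x != 0 -> O x /\ ~ P x]].
Proof.
move=> [crX hX] oO infKO.
have [a [Ka Oa]] : K `&` O !=set0 by apply: infinite_setN0.
have [b [[Kb Ob] ba]] : (K `&` O) `\ a !=set0.
  by apply: infinite_setN0; apply: infinite_setD => //; exact: finite_set1.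
have /(@uniform_separatorP _ R)[f [cf f01 fa fb]] :
    uniform_separator [set a] [set b].
  apply: crX; first exact/accessible_closed_set1/hausdorff_accessible.
  by move=> /= ab; apply: ba.
have {}fa : f a = 0 by apply: fa; exists a.
have {}fb : f b = 1 by apply: fb; exists b.
have of_lt c : open (O `&` [set x | f x < c]).
  apply: openI => //; apply: (@open_comp _ _ f [set y | y < c]) => [x _|].
    exact: cf.
  exact: open_lt.
have of_gt c : open (O `&` [set x | c < f x]).
  apply: openI => //; apply: (@open_comp _ _ f [set y | c < y]) => [x _|].
    exact: cf.
  exact: open_gt.
have [inf3|fin3] :=
    pselect (infinite_set (K `&` (O `&` [set x | 1 / 3 < f x]))).
  have [|psi [cpsi psi01 psia psiO]] :=
    exists_bump crX (of_lt (1 / 3)) (a := a).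
    by split=> //=; rewrite fa.
  exists a, psi, (O `&` [set x | 1 / 3 < f x]); split=> //; split=> //.
  by move=> x /psiO[Ox /= x1]; split=> // -[_ /=]; lra.
have [|psi [cpsi psi01 psib psiO]] := exists_bump crX (of_gt (2 / 3)) (a := b).
  by split=> //=; rewrite fb; lra.
exists b, psi, (O `&` [set x | f x < 2 / 3]); split=> //; split=> //.
  move=> fin2; apply: infKO.
  have : finite_set (K `&` (O `&` [set x | f x < 2 / 3]) `|`
                     K `&` (O `&` [set x | 1 / 3 < f x])).
    by rewrite finite_setU; split; [exact: fin2|exact: contrapT fin3].
  apply: sub_finite_set.
  move=> x [Kx Ox]; have [x3|x3] := ltP (f x) (2 / 3); first by left.
  by right; split=> //; split=> //=; lra.
by move=> x /psiO[Ox /= x1]; split=> // -[_ /=]; lra.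
Qed.

Lemma exists_disjoint_bumps (K : set X) : tychonoff_space X -> infinite_set K ->
  exists (t : nat -> X) (psi : nat -> X -> R),
    [/\ forall n, K (t n), forall n, continuous (psi n),
        forall n x, 0 <= psi n x <= 1, forall n, psi n (t n) = 1 &
        forall i j x, psi i x != 0 -> psi j x != 0 -> i = j].
Proof.
move=> tX infK.
pose T := {O : set X | open O /\ infinite_set (K `&` O)}.
have step (x : T) :=
  exists_bump_leaving_infinite tX (svalP x).1 (svalP x).2.
have [t tP] := choice step; have [psi psiP] := choice tP.
have [P OP] := choice psiP.
pose next (x : T) : T := exist _ (P x)
  (conj (let: And5 _ _ _ _ (And4 o _ _ _) := OP x in o)
        (let: And5 _ _ _ _ (And4 _ i _ _) := OP x in i)).
have TP : open [set: X] /\ infinite_set (K `&` setT).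
  by split; [exact: openT|rewrite setIT].
pose O i := iter i next (exist _ _ TP).
have OS i : sval (O i.+1) = P (O i) by [].
have Omono i k : sval (O (k + i)%N) `<=` sval (O i).
  elim: k => // k IHk; rewrite addSn OS; apply: subset_trans IHk.
  by have [_ _ _ _ []] := OP (O (k + i)%N).
exists (t \o O), (psi \o O); split=> [n|n|n|n|i j x] /=;
  try by have [] := OP (O n).
have disj i' j' : (i' < j')%N -> psi (O i') x != 0 -> psi (O j') x != 0 -> False.
  move=> ij; have [_ _ _ _ [_ _ _ Pi]] := OP (O i').
  have [_ _ _ _ [_ _ _ Pj]] := OP (O j').
  move=> /Pi[_ nO] /Pj[Oj _]; apply: nO; rewrite -OS.
  by apply: (Omono _ (j' - i'.+1)%N); rewrite subnK.
by have [ij|ij|//] := ltngtP i j => pi pj; exfalso;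
  [exact: disj ij pi pj|exact: disj ij pj pi].
Qed.

End bumps.

(** * Complemented copies of c0p *)

Section retract.
Context (R : realType).

Lemma closed_zero (V : tvsType R) :
  (forall v : V, v != 0 -> exists2 phi : V -> R^o,
     continuous phi & phi 0 = 0 /\ phi v != 0) ->
  closed [set (0 : V)].
Proof.
move=> sep v clv; apply: contrapT => /eqP v0.
have [phi cphi [phi0 phiv]] := sep v v0.
have phi_nbhs : nbhs v [set w | phi w != 0].
  apply: (cphi v [set y | y != 0]); apply: open_nbhs_nbhs.
  by split=> //; exact: open_neq.
have [w [/= -> /=]] := clv _ phi_nbhs.
by rewrite phi0 eqxx.
Qed.

(** The summands are the range of [T], which is the set of fixed points of
    [T \o S], and the kernel of [S]. *)
Lemma complemented_copy_of_retract (G F : tvsType R)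
    (T : {linear F -> G}) (S : {linear G -> F}) :
  continuous T -> continuous S -> cancel T S ->
  closed [set (0 : F)] -> closed [set (0 : G)] ->
  contains_complemented_copy G F.
Proof.
move=> cT cS TS F0 G0.
have cTS : continuous (T \o S).
  by move=> g; apply: continuous_comp; [exact: cS|exact: cT].
exists [set g | T (S g) = g], [set g | S g = 0]; split.
- split.
    split=> [|a g h]; rewrite !inE /= ?linear0// => Tg Th.
    by rewrite !linearP Tg Th.
  have cD : continuous (fun g => g - T (S g)).
    move=> g; have cg : (fun y => (y, T (S y))) @ g --> (g, T (S g)).
      by apply: cvg_pair; [exact: cvg_id|exact: cTS].
    exact: (cvg_comp _ _ cg (@sub_continuous G (g, T (S g)))).
  have -> : [set g | T (S g) = g] = (fun g => g - T (S g)) @^-1` [set 0].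
    by apply/seteqP; split=> g /= => [->|/subr0_eq]; rewrite ?subrr.
  by apply: preimage_closed => // x _; exact: cD.
- split.
    split=> [|a g h]; rewrite !inE /= ?linear0// => Sg Sh.
    by rewrite linearP Sg Sh scaler0 addr0.
  by apply: (@preimage_closed _ _ S [set 0]) => // x _; exact: cS.
- split.
    apply/seteqP; split=> // g _; exists (T (S g)); first by rewrite /= TS.
    by exists (g - T (S g)); rewrite /= ?linearB /= ?TS ?subrr// addrC subrK.
  apply/seteqP; split=> g /= => [[<-]|->].
    by rewrite TS => ->; rewrite linear0.
  by rewrite !linear0.
- exists T, S; split=> //.
  + by move=> x; rewrite /= TS.
  + by move=> g /set_mem.
  + exact: continuous_subspaceT.
- exists (T \o S) => // g; rewrite /= TS; split=> //.
  by rewrite linearB /= TS subrr.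
Qed.

End retract.

Section initial_maps.
Context (R : realType).

Lemma sub_tvs_val_continuous (V : tvsType R) (A : set V)
    (A_submod : submod_closed [in A]) :
  continuous (\val : sub_tvs A_submod -> V).
Proof.
by move=> x; exact: ((@cvg_sub_tvsP R V A A_submod (nbhs x) x _).1 cvg_id tt).
Qed.

Lemma ptws_eval_continuous (X : Type) (F : tvsType R) (x : X) :
  continuous (@ptws_eval R X F x).
Proof. by move=> g; exact: ((@cvg_ptwsP R X F (nbhs g) g _).1 cvg_id x). Qed.

Lemma weak_eval_continuous (E : tvsType R) (G : dual E) :
  continuous (@weak_eval R E G).
Proof. by move=> v; exact: ((@cvg_weakP R E (nbhs v) v _).1 cvg_id G). Qed.

End initial_maps.

Section c0p_copy.
Context (R : realType) (X : topologicalType) (E : tvsType R).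
Context (t : nat -> X) (psi : nat -> X -> R) (e : nat -> E).
Context (f : nat -> {linear E -> R^o}).
Hypothesis hE : hausdorff_space E.
Hypothesis psi_continuous : forall n, continuous (psi n).
Hypothesis psi01 : forall n x, 0 <= psi n x <= 1.
Hypothesis psi_t : forall n, psi n (t n) = 1.
Hypothesis psi_disjoint : forall i j x, psi i x != 0 -> psi j x != 0 -> i = j.
Hypothesis e_bounded : forall G : {linear E -> R^o}, continuous (G : E -> R^o) ->
  bounded_map (fun n => G (e n) : R).
Hypothesis f_continuous : forall n, continuous (f n : E -> R^o).
Hypothesis f_e : forall n, f n (e n) = 1.
Hypothesis f_null : forall h : X -> weak E, continuous h ->
  f n (h (t n)) @[n --> \oo] --> (0 : R^o).

Let bump_index (x : X) : nat := xget 0%N [set n | psi n x != 0].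

Let bump_indexE n x : psi n x != 0 -> bump_index x = n.
Proof.
move=> px; rewrite /bump_index; case: xgetP => [m _ pm|/(_ n)//].
exact: psi_disjoint pm px.
Qed.

(** The sum over [n] of [(a n * psi n x) *: e n], written with its only term
    that may differ from [0]. *)
Definition bump_series (a : nat -> R) (x : X) : weak E :=
  (a (bump_index x) * psi (bump_index x) x) *: (e (bump_index x) : weak E).

(** After composition with [G] in the dual of [E] the series converges uniformly,
    since [a] tends to [0] and [G] is bounded on the [e n]. *)
Lemma bump_series_continuous (a : nat -> R) :
  a n @[n --> \oo] --> 0 -> continuous (bump_series a).
Proof.
move=> a0; apply/weak_continuousP => G cG.
have [C GC] := e_bounded cG.
have C0 : 0 <= C by exact: le_trans (GC 0%N).
pose g x : R := G (bump_series a x).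
pose gN N x : R := \sum_(0 <= n < N) a n * psi n x * G (e n).
have gE x : g x = a (bump_index x) * psi (bump_index x) x * G (e (bump_index x)).
  by rewrite /g linearZ.
have gNE N x : gN N x = if (bump_index x < N)%N then g x else 0.
  have E0 n : n != bump_index x -> psi n x = 0.
    by move=> ni; apply: contraNeq ni => /bump_indexE->.
  case: ltnP => iN.
    rewrite /gN big_mkord (bigD1 (Ordinal iN))//= big1 ?addr0 ?gE// => n.
    by rewrite -val_eqE /= => /E0 ->; rewrite mulr0 mul0r.
  rewrite /gN big_nat_cond big1// => n; rewrite andbT => /andP[_ nN].
  by rewrite E0 ?mulr0 ?mul0r// ltn_eqF// (leq_trans nN).
move=> x; apply/cvgrPdist_le => d d0 /=.
have c0 : 0 < d / (4 * (C + 1)) by rewrite divr_gt0// mulr_gt0// ltr_wpDl.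
have /cvgr0Pnorm_le/(_ _ c0)[N _ aN] := a0.
have tail y : `|g y - gN N y| <= d / 4.
  rewrite gNE; case: ltnP => iN; first by rewrite subrr normr0 divr_ge0// ltW.
  rewrite subr0 gE !normrM.
  have := aN _ iN; rewrite /= => ai; have := GC (bump_index y).
  have /andP[p0 p1] := psi01 (bump_index y) y.
  rewrite (ger0_norm p0) => Gi.
  apply: (@le_trans _ _ (d / (4 * (C + 1)) * (C + 1))); last first.
    have -> : d / (4 * (C + 1)) * (C + 1) = d / 4; last by [].
    by field; rewrite gt_eqF// ltr_wpDl.
  apply: ler_pM => //; first by rewrite mulr_ge0.
    by rewrite (le_trans _ ai)// ler_piMr.
  by rewrite (le_trans Gi)// lerDl.
have cgN : gN N y @[y --> x] --> gN N x.
  elim: (N) => [|m IHm].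
    rewrite (_ : gN 0%N = fun=> 0); first exact: cvg_cst.
    by apply/funext => y; rewrite /gN big_geq.
  rewrite (_ : gN m.+1 = fun y => gN m y + a m * psi m y * G (e m)).
    apply: cvgD; first exact: IHm.
    by apply: cvgMr_tmp; apply: cvgMl_tmp; exact: psi_continuous.
  by apply/funext => y; rewrite /gN big_nat_recr.
have /cvgrPdist_le/(_ (d / 2) ltac:(by rewrite divr_gt0)) := cgN.
apply: filterS => y xy; rewrite -/(g x) -/(g y).
have tx := tail x; have := tail y; rewrite distrC => ty.
have -> : g x - g y = (g x - gN N x) + (gN N x - gN N y) + (gN N y - g y) by ring.
rewrite (le_trans (ler_normD _ _))//.
have := ler_normD (g x - gN N x) (gN N x - gN N y); lra.
Qed.

Let V : tvsType R := {ptws X -> weak E}.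
Let CpX := sub_tvs (@continuous_submod R X (weak E)).
Let C0 := sub_tvs (@c0_submod R).

Let c0_cvg (a : C0) : (\val a : nat -> R^o) n @[n --> \oo] --> (0 : R^o).
Proof. exact: set_mem (valP a). Qed.

Let Cp_continuous (h : CpX) : continuous (\val h : X -> weak E).
Proof. exact: set_mem (valP h). Qed.

Definition c0p_embed (a : C0) : CpX :=
  exist (fun g : V => g \in [set g : V | continuous (g : X -> weak E)])
    (bump_series (\val a : nat -> R^o))
    (mem_set (bump_series_continuous (@c0_cvg a))).

Definition c0p_coordinates (h : CpX) : C0 :=
  exist (fun a : {ptws nat -> R^o} =>
      a \in [set a | (a : nat -> R^o) n @[n --> \oo] --> (0 : R^o)])
    (fun n => f n ((\val h : X -> weak E) (t n)))
    (mem_set (f_null (@Cp_continuous h))).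

Lemma c0p_embed_linear : linear c0p_embed.
Proof.
move=> a u v; apply/val_inj/funext => x.
rewrite /= /bump_series; rewrite [RHS]/GRing.add /= [in RHS]/GRing.scale /=.
by rewrite scalerA -scalerDl mulrDl mulrA.
Qed.

Lemma c0p_coordinates_linear : linear c0p_coordinates.
Proof.
move=> a g h; apply/val_inj/funext => n /=.
exact: linearP.
Qed.

HB.instance Definition _ :=
  GRing.isLinear.Build R C0 CpX *:%R c0p_embed c0p_embed_linear.
HB.instance Definition _ :=
  GRing.isLinear.Build R CpX C0 *:%R c0p_coordinates c0p_coordinates_linear.

Lemma c0p_embed_continuous : continuous c0p_embed.
Proof.
move=> a; have FF := fmap_filter c0p_embed (nbhs_filter a).
apply: ((cvg_sub_tvsP _ FF).2) => _.
have FF1 := fmap_filter (\val : CpX -> V) FF.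
apply: ((cvg_ptwsP _ FF1).2) => x.
have FF2 := fmap_filter (@ptws_eval R X (weak E) x) FF1.
apply: ((cvg_weakP _ FF2).2) => -[G cG].
rewrite -!fmap_comp.
set k := bump_index x.
rewrite (_ : _ \o _ = fun u : C0 => (\val u : nat -> R^o) k * psi k x * G (e k)).
  rewrite [weak_eval _ _](_ : _ = (\val a : nat -> R^o) k * psi k x * G (e k)).
    apply: cvgMr_tmp; apply: cvgMr_tmp.
    have := @sub_tvs_val_continuous R _ _ (@c0_submod R) a.
    move=> va.
    exact: (cvg_comp _ _ va (@ptws_eval_continuous R nat R^o k (\val a))).
  by rewrite /weak_eval /= /bump_series linearZ.
by apply/funext => u; rewrite /weak_eval /= /bump_series linearZ.
Qed.

Lemma c0p_coordinates_continuous : continuous c0p_coordinates.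
Proof.
move=> h; have FF := fmap_filter c0p_coordinates (nbhs_filter h).
apply: ((cvg_sub_tvsP _ FF).2) => _.
have FF1 := fmap_filter (\val : C0 -> {ptws nat -> R^o}) FF.
apply: ((cvg_ptwsP _ FF1).2) => n.
rewrite -!fmap_comp.
have vh := @sub_tvs_val_continuous R _ _ (@continuous_submod R X (weak E)) h.
have ph := cvg_comp _ _ vh (@ptws_eval_continuous R X (weak E) (t n) (\val h)).
exact: (cvg_comp _ _ ph (@weak_eval_continuous R E
  (exist _ (f n : {linear E -> R^o}) (@f_continuous n)) _)).
Qed.

Lemma c0p_embedK : cancel c0p_embed c0p_coordinates.
Proof.
move=> a; apply/val_inj/funext => n /=.
have tn : bump_index (t n) = n by apply: bump_indexE; rewrite psi_t oner_neq0.
by rewrite /bump_series tn psi_t mulr1 linearZ /= f_e /GRing.scale /= mulr1.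
Qed.

Lemma c0p_closed_zero : closed [set (0 : C0)].
Proof.
apply: closed_zero => a a0.
have [n an] : exists n, (\val a : nat -> R^o) n != 0.
  apply: contrapT => na; move/eqP: a0; apply; apply/val_inj/funext => n /=.
  by apply/eqP; apply: contrapT => /negP an; apply: na; exists n.
exists (fun b : C0 => (\val b : nat -> R^o) n) => //.
move=> b; have vb := @sub_tvs_val_continuous R _ _ (@c0_submod R) b.
exact: (cvg_comp _ _ vb (@ptws_eval_continuous R nat R^o n (\val b))).
Qed.

Lemma Cp_closed_zero : closed [set (0 : CpX)].
Proof.
apply: closed_zero => h h0.
have [x hx] : exists x, ((\val h : X -> weak E) x : E) != 0.
  apply: contrapT => nx; move/eqP: h0; apply; apply/val_inj/funext => x /=.
  by apply/eqP; apply: contrapT => /negP hx; apply: nx; exists x.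
have [G cG Gx] := separating_functional hE hx.
exists (fun g : CpX => G ((\val g : X -> weak E) x)).
  move=> g.
  have vg := @sub_tvs_val_continuous R _ _ (@continuous_submod R X (weak E)) g.
  have pg := cvg_comp _ _ vg (@ptws_eval_continuous R X (weak E) x (\val g)).
  exact: (cvg_comp _ _ pg (@weak_eval_continuous R E (exist _ G cG) _)).
by split=> //; exact: linear0.
Qed.

Lemma c0p_complemented : contains_complemented_copy (Cp X (weak E)) (c0p R).
Proof.
exact: (@complemented_copy_of_retract R CpX C0 c0p_embed c0p_coordinates
  c0p_embed_continuous c0p_coordinates_continuous c0p_embedK
  c0p_closed_zero Cp_closed_zero).
Qed.

End c0p_copy.

Theorem theorem7p2 (R : realType) (X : topologicalType) (E : tvsType R) :
  tychonoff_space X ->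
  (exists K : set X, compact K /\ infinite_set K) ->
  hausdorff_space E ->
  contains_copy E (l1 R) ->
  contains_complemented_copy (Cp X (weak E)) (c0p R).
Proof.
move=> tX [K [cK infK]] hE l1E.
have [t [psi [Kt cpsi psi01 psit psi_disj]]] := exists_disjoint_bumps R tX infK.
have [e [p [F [cp Fp Fe eb]]]] := l1_copy_functionals l1E.
have [W [WU Woo]] :=
  ultraFilterLemma (eventually_filter : ProperFilter (\oo : set_system nat)).
apply: (c0p_complemented (t := t) (psi := psi) (e := e)
  (f := fun n => [the {linear E -> R^o} of coefficient W F n])) => //.
- by move=> n; exact: (coefficient_continuous WU cp Fp).
- move=> n.
  transitivity (sign_mean W (fun s => rademacher R n s * rademacher R n s)).
    by congr (sign_mean W _); apply/funext => s; rewrite Fe.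
  by rewrite (sign_mean_orthonormal R WU Woo) eqxx.
- by move=> h ch; exact: (coefficient_cvg0 WU Woo cp Fp cK ch Kt).
Qed.
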